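(* Suppose positivity of topological entropy is an invariant of Turing equivalence, i.e. $h(T)>0$ if and only if $h(S)>0$ whenever $(X,T)\sim_p(Y,S)$. Then there exist hard telic problems, and in particular $\mathsf{P}\ne\mathsf{NP}$.
   Context: **Dynamical systems.** A dynamical system is a pair $(X,T)$ where $X\subseteq\mathbb{R}^m$ is infinite and carries the subspace topology induced by the Euclidean metric $\rho$, and $T:X\to X$ is a map; $T^n$ is the $n$-fold composition. It is a topological dynamical system if $X$ is a compact and connected subset of Euclidean space and $T$ is continuous (and a homeomorphism if $T$ is invertible). The circle $S^1=\mathbb{R}/\mathbb{Z}$, viewed as the unit interval with endpoints identified, is also treated as a state space. **Topological entropy.** For $X$ compact and $T$ continuous put $\rho_n(x,y)=\max\{\rho(T^i(x),T^i(y)):0\le i<n\}$. A set $E\subset X$ is $(n,\varepsilon)$-separated if each pair of distinct points of $E$ is at least $\varepsilon$ apart in $\rho_n$. $N(n,\varepsilon)$ is the maximum cardinality of an $(n,\varepsilon)$-separated set, and $h(T)=\lim_{\varepsilon\to0}\bigl(\limsup_{n\to\infty}\frac1n\log N(n,\varepsilon)\bigr)$. **Discretization of spaces.** $\langle\cdot\rangle$ is binary encoding, $1^n$ is the unary encoding of $n$, $\{1\}^*$ is the set of unary strings. $\mathbb{D}_r=\{m2^{-r}:m\in\mathbb{Z}\}$. An $r$-discretization of $X\subseteq\mathbb{R}^d$ is a selected subset $X_r\subseteq\mathbb{D}_r^d$ such that for every $x\in X$ there is $x_r\in X_r$ with $\|x-x_r\|_2\le 2^{-r}$. Its operator $\mathsf{D}_r:X\to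 X_r$ sends $x$ to the closest point of $X_r$ in the 2-norm (if there are several, the lowest one); it is a rounding operator, computable in polynomial time. For $A\subseteq X$, $A_r=\mathsf{D}_r(A)$. $X$ is efficiently discretizable if membership of a point of $\mathbb{D}_r^d$ in $X_r$ can be decided in time polynomial in $r$. $X$ contains its $r$-discretizations if $X_r\subseteq X$ for all $r\in\mathbb{N}$. $X_*=\bigcup_{r\ge1}X_r$. $I_r^d$ is the $r$-discretization of $[0,1]^d$, identified with $(\{0,1\}^r)^d$. **Efficiently discretizable bijections.** A bijection $f:X\to X$ is efficiently discretizable with inverse if there are uniformly and polynomial-time computable families of functions $f_r:X_r\to X_r$ and $f_r^{-1}:X_r\to X_r$, $r\ge1$, such that (1) for all $r$ and $x\in X_r$, $f_r(x)=\mathsf{D}_r(f(y))$, where $y=x$ if $x\in X$ and $y\in\mathsf{D}_r^{-1}(x)$ otherwise, and similarly for $f_r^{-1}$ with $f^{-1}$ in place of $f$; (2) $f_r\circ f_r^{-1}=f_r^{-1}\circ f_r=\mathrm{Id}$. **Efficiently discretizable systems.** $(X,T)$, with $X$ efficiently discretizable, is efficiently discretizable if there is a polynomial-time Turing machine $\mathsf{M}_T:X_*\times\{1\}^*\times\{1\}^*\to X_*$ (the discretization of $T$) such that $\mathsf{M}_T(\langle x\rangle,1^k,1^r)=\mathsf{D}_r(T^k(y))$, where $y=x$ if $X$ contains its $r$-discretizations and $y\in\mathsf{D}_r^{-1}(x)$ otherwise. **Feasibly queryable maps.** For $X\subset\mathbb{R}^m$ efficiently discretizable and $1\le d\le m$,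 maps $g^{(i)}:I_i^d\to X_{r_i}\cup\{\perp\}$ ($i\ge1$, where $r_i\ge i$ is determined by $g^{(i)}$ and $\perp$ is a blank symbol) have the neighborhood preservation property if for all $i$, for every $x_0\in[0,1]^d$ and $\varepsilon=\sqrt d/2^i$, there are $\delta>0$ and $y_0\in X$ such that for all $x\in I_i^d$: $x\in\overline{B_\varepsilon(x_0)}$ if and only if $g^{(i)}(x)\in\overline{B_\delta(y_0)}\cup\{\perp\}$. They are feasibly queryable if in addition there is a Turing machine $\mathsf{G}$ running in time $O(i^c)$, $c\in\mathbb{N}$, with $\mathsf{G}(\langle x\rangle)=\langle g^{(i)}(x)\rangle$ where $|\langle x\rangle|=di$. **Telic problems.** Let $(X,T)$, $X\subseteq\mathbb{R}^m$, be efficiently discretizable with discretization $\mathsf{M}_T$. Data: (a) feasibly queryable maps $g^{(i)}:I_i^d\to X_{r_i}\cup\{\perp\}$, $d\le m$; a map $H:X\cup\{\perp\}\to X\cup\{\perp\}$ with $H(\perp)=\perp$ whose restriction $\hat H=H|_X:X\to X$ is a bijection that is efficiently discretizable with inverse and commutes with $T$; a fixed $\ell\in\mathbb{Z}^+$; maps $h^{(i)}=\hat H_{r_i}^{\ell}\circ g^{(i)}$ (with $\perp\mapsto\perp$); and a polynomial-time Turing machine $\mathsf{H}$ with $\mathsf{H}(\langle x\rangle)=\langle h^{(i)}(x)\rangle$ for $x\in I_i^d$; (b) a polynomial-time Turing machine $\mathsf{V}$ with $\mathsf{V}(1^n)=1^{v(n)}$, $v(n)=Cn$ for some integer $C\ge1$;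 (c) sets $B^{(i)}=\hat H^{\ell}(R^{(i)})\cap X\ne\emptyset$, where $R^{(i)}\subset\mathbb{R}^m$ is a closed rational rectangle meeting $X$, with a polynomial-time algorithm $\mathsf{B}$ that on input $x\in X_{v(i)}$ returns $1$ if $x\in B^{(i)}_{v(i)}:=\mathsf{D}_{v(i)}(B^{(i)})$ and $0$ otherwise. The telic problem coming from $(X,T)$ with these data is the problem of deciding membership in the unary language $$\{1^n:\exists s\in I_n^d\text{ such that }\mathsf{B}(\mathsf{M}_T(\mathsf{H}(\langle s\rangle),1^n,\mathsf{V}(1^n)))=1\}.$$ A telic problem is easy if it is decided by a (deterministic) Turing machine running in time $O(n^c)$ for some $c\in\mathbb{N}$, and hard otherwise. **Reductions.** Reductions between telic problems are Karp reductions (polynomial-time many-one reductions). For efficiently discretizable topological dynamical systems, $(X,T)\le_p(Y,S)$ means that every telic problem coming from $(X,T)$ reduces to some telic problem coming from $(Y,S)$. The systems are Turing equivalent, $(X,T)\sim_p(Y,S)$, if $(X,T)\le_p(Y,S)$ and $(Y,S)\le_p(X,T)$. *)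

(* Defs.v *)
From mathcomp Require Export all_boot all_order all_algebra finmap.
From mathcomp Require Export all_classical all_reals all_analysis.

Set Implicit Arguments.
Unset Strict Implicit.
Unset Printing Implicit Defensive.
Import Order.TTheory GRing.Theory Num.Theory.
Import numFieldNormedType.Exports.
Local Open Scope classical_set_scope.
Local Open Scope ring_scope.

(** * Deterministic multi-tape Turing machines *)

(* The tape alphabet is {0, 1, #, blank}: [Some b] is the bit [b], [None] in
   [symbol] is the separator #, and [None] in [cell] is the blank. *)
Definition symbol : finType := option bool.
Definition word := seq symbol.
Definition cell : finType := option symbol.

Inductive direction := GoLeft | Stay | GoRight.

Definition shift_of (a : direction) : int :=
  match a with GoLeft => -1 | Stay => 0 | GoRight => 1 end.

(* The input is written on tape [ord0], the output is read on tape [ord_max]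
   (the same tape when [tm_extra = 0]). *)
Record turing_machine := TuringMachine {
  tm_extra : nat;
  tm_state : finType;
  tm_start : tm_state;
  tm_halted : pred tm_state;
  tm_step : tm_state -> {ffun 'I_tm_extra.+1 -> cell} ->
            tm_state * ('I_tm_extra.+1 -> cell * direction) }.

Record config (M : turing_machine) := Config {
  cf_state : tm_state M;
  cf_tape : 'I_(tm_extra M).+1 -> int -> cell;
  cf_head : 'I_(tm_extra M).+1 -> int }.

Definition word_at (w : word) (z : int) : cell :=
  match z with Posz n => onth w n | Negz _ => None end.

Definition init_config (M : turing_machine) (w : word) : config M :=
  Config (tm_start M)
    (fun j => if j == ord0 then word_at w else fun=> None) (fun=> 0).

Definition step_config (M : turing_machine) (c : config M) : config M :=
  if tm_halted (cf_state c) then c else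
  let qa := tm_step (cf_state c) [ffun j => cf_tape c j (cf_head c j)] in
  Config qa.1
    (fun j z => if z == cf_head c j then (qa.2 j).1 else cf_tape c j z)
    (fun j => cf_head c j + shift_of (qa.2 j).2).

(* The output tape holds exactly [u], and the head is on its first symbol. *)
Definition halts_with (M : turing_machine) (w : word) (t : nat) (u : word) :=
  let c := iter t (@step_config M) (init_config M w) in
  tm_halted (cf_state c) /\
  forall z : int, cf_tape c ord_max (cf_head c ord_max + z) = word_at u z.

Definition polybound (c n : nat) : nat := (c * n ^ c + c)%N.

Definition polytime (f : word -> word) : Prop :=
  exists (M : turing_machine) (c : nat), forall w : word,
  exists2 t, (t <= polybound c (size w))%N & halts_with M w t (f w).

(** * Languages, P, NP and Karp reductions *)

Definition language := set (seq bool).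

Definition wbits (s : seq bool) : word := map Some s.

Definition yes : word := [:: Some true].
Definition no : word := [:: Some false].

Definition unary (n : nat) : word := wbits (nseq n true).

Definition class_P : set language := [set L | exists2 f, polytime f &
  forall w, (L w -> f (wbits w) = yes) /\ (~ L w -> f (wbits w) = no)].

Definition class_NP : set language := [set L | exists (f : word -> word) (c : nat),
  polytime f /\
  forall w, L w <-> exists2 u : seq bool, (size u <= polybound c (size w))%N &
    f (wbits w ++ None :: wbits u) = yes].

Definition karp_reduces (L L' : language) : Prop :=
  exists2 f, polytime f & exists2 g : seq bool -> seq bool,
    (forall w, f (wbits w) = wbits (g w)) & (forall w, L w <-> L' (g w)).

(** * State spaces *)

Section Systems.
Variable R : realType.

(* [Circular] is for R/Z, whose points are represented in [0, 1[. *)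
Inductive geometry := Euclidean | Circular.

Definition coord_dist (g : geometry) (a b : R) : R :=
  match g with
  | Euclidean => `|a - b|
  | Circular =>
      let t := `|(a - (Num.floor a)%:~R) - (b - (Num.floor b)%:~R)| in
      Num.min t (1 - t)
  end.

Definition dist (g : geometry) (m : nat) (x y : 'rV[R]_m) : R :=
  Num.sqrt (\sum_(j < m) coord_dist g (x ord0 j) (y ord0 j) ^+ 2).

Record state_space := StateSpace {
  sp_dim : nat;
  sp_geom : geometry;
  carrier : set 'rV[R]_sp_dim;
  carrier_infinite : infinite_set carrier;
  carrier_circle : sp_geom = Circular -> sp_dim = 1%N /\
    carrier = [set x | forall j, 0 <= x ord0 j < 1] }.

Arguments carrier : clear implicits.

Definition rho (X : state_space) : 'rV[R]_(sp_dim X) -> 'rV[R]_(sp_dim X) -> R :=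
  @dist (sp_geom X) (sp_dim X).

(* The points of [A] in R^m, or their classes mod 1 for the circle, that
   lie in [X]. *)
Definition trace (X : state_space) (A : set 'rV[R]_(sp_dim X)) :
    set 'rV[R]_(sp_dim X) :=
  [set x | carrier X x /\ match sp_geom X with
    | Euclidean => A x
    | Circular => exists2 z, A z & forall j, x ord0 j - z ord0 j \is a Num.int
    end].

Definition self_map (X : state_space) (T : 'rV[R]_(sp_dim X) -> 'rV[R]_(sp_dim X)) :=
  forall x, carrier X x -> carrier X (T x).

(** * Dyadic points, their encodings, discretizations *)

Definition dyadic (m r : nat) : set 'rV[R]_m :=
  [set x | forall j, x ord0 j * 2 ^+ r \is a Num.int].

(* Most significant bit first. *)
Definition nbits (r n : nat) : seq bool :=
  rev [seq odd (n %/ 2 ^ i) | i <- iota 0 r].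
Definition binary (n : nat) : seq bool := nbits (trunc_log 2 n).+1 n.
Definition bits_value (s : seq bool) : nat :=
  foldl (fun (n : nat) (b : bool) => (n.*2 + b)%N) 0%N s.

(* Sign, integer part, #, exactly [r] fractional digits, #: the precision is
   readable from the code. *)
Definition enc_coord (r : nat) (a : R) : word :=
  let n := Num.floor (a * 2 ^+ r) in
  wbits ((n < 0) :: binary (`|n| %/ 2 ^ r)%N) ++
  None :: wbits (nbits r (`|n| %% 2 ^ r)%N) ++ [:: None].

Definition enc (m r : nat) (x : 'rV[R]_m) : word :=
  flatten [seq enc_coord r (x ord0 j) | j <- enum 'I_m].

(* The blank symbol, represented by [None], is encoded by the empty word. *)
Definition enc_blank (m r : nat) (x : option 'rV[R]_m) : word :=
  if x is Some y then enc r y else [::].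

Definition cube (d r : nat) := d.-tuple (r.-tuple bool).

Definition cube_point (d r : nat) (s : cube d r) : 'rV[R]_d :=
  \row_(j < d) ((bits_value (tnth s j))%:R / 2 ^+ r).

Definition enc_cube (d r : nat) (s : cube d r) : word :=
  wbits (flatten [seq val t | t <- val s]).

Definition is_discretization (X : state_space) (r : nat)
    (Xr : set 'rV[R]_(sp_dim X)) : Prop :=
  [/\ Xr `<=` @dyadic (sp_dim X) r,
      (sp_geom X = Circular -> Xr `<=` carrier X) &
      forall x, carrier X x -> exists2 z, Xr z & rho x z <= 2 ^- r].

Definition lexle (m : nat) (x y : 'rV[R]_m) : Prop :=
  x = y \/ exists j : 'I_m, x ord0 j < y ord0 j /\
    forall k : 'I_m, (k < j)%N -> x ord0 k = y ord0 k.

(* [rounds Xr x z] means that [z] is the image of [x] under the rounding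
   operator onto [Xr]; ties go to the lexicographically lowest point. *)
Definition rounds (X : state_space) (Xr : set 'rV[R]_(sp_dim X))
    (x z : 'rV[R]_(sp_dim X)) : Prop :=
  Xr z /\ forall y, Xr y -> rho x z <= rho x y /\ (rho x y = rho x z -> lexle z y).

Definition efficient_discretization (X : state_space)
    (D : nat -> set 'rV[R]_(sp_dim X)) : Prop :=
  (forall r, (0 < r)%N -> is_discretization r (D r)) /\
  exists (M : turing_machine) (c : nat),
    forall r x, (0 < r)%N -> dyadic r x ->
    exists2 t, (t <= polybound c r)%N &
      halts_with M (enc r x) t (if `[< D r x >] then yes else no).

Definition contains_discretizations (X : state_space)
    (D : nat -> set 'rV[R]_(sp_dim X)) : Prop :=
  forall r, (0 < r)%N -> D r `<=` carrier X.

(** * Efficiently discretizable systems *)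

Definition triple (w1 w2 w3 : word) : word := w1 ++ None :: w2 ++ None :: w3.

(* When [X] contains its discretizations, the argument [x] may be given with a
   precision [s] that differs from the precision [r] of the result. *)
Definition map_discretization (X : state_space)
    (T : 'rV[R]_(sp_dim X) -> 'rV[R]_(sp_dim X))
    (D : nat -> set 'rV[R]_(sp_dim X)) (MT : word -> word) : Prop :=
  [/\ polytime MT,
      forall s k r x, (0 < s)%N -> (0 < r)%N -> D s x ->
        exists t z, [/\ (0 < t)%N, D t z &
          MT (triple (enc s x) (unary k) (unary r)) = enc t z],
      contains_discretizations D ->
        forall s k r x, (0 < s)%N -> (0 < r)%N -> D s x ->
        exists2 z, rounds (D r) (iter k T x) z &
          MT (triple (enc s x) (unary k) (unary r)) = enc r z &
      ~ contains_discretizations D ->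
        forall s k r x, (0 < s)%N -> (0 < r)%N -> D s x -> D r x ->
        exists y z, [/\ carrier X y, rounds (D r) y x, rounds (D r) (iter k T y) z &
          MT (triple (enc s x) (unary k) (unary r)) = enc r z]].

Record ed_system := EDSystem {
  ed_space :> state_space;
  ed_map : 'rV[R]_(sp_dim ed_space) -> 'rV[R]_(sp_dim ed_space);
  ed_self : self_map ed_map;
  ed_disc : nat -> set 'rV[R]_(sp_dim ed_space);
  ed_disc_eff : efficient_discretization ed_disc;
  ed_machine : word -> word;
  ed_machineP : map_discretization ed_map ed_disc ed_machine }.

Arguments ed_map : clear implicits.
Arguments ed_disc : clear implicits.

Definition continuous_map (X : state_space)
    (T : 'rV[R]_(sp_dim X) -> 'rV[R]_(sp_dim X)) : Prop :=
  forall x e, carrier X x -> 0 < e -> exists2 delta, 0 < delta &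
    forall y, carrier X y -> rho x y < delta -> rho (T x) (T y) < e.

(* The circle itself is compact and connected. An invertible continuous map
   of a compact space is automatically a homeomorphism. *)
Definition topological (S : ed_system) : Prop :=
  continuous_map (ed_map S) /\
  (sp_geom S = Euclidean -> compact (carrier S) /\ connected (carrier S)).

(** * Topological entropy *)

Definition rho_n (S : ed_system) (n : nat) (x y : 'rV[R]_(sp_dim S)) : R :=
  \big[Num.max/0]_(i < n)
    rho (iter i (ed_map S) x) (iter i (ed_map S) y).

Definition separated (S : ed_system) (n : nat) (e : R)
    (E : {fset 'rV[R]_(sp_dim S)}) : Prop :=
  [set` E] `<=` carrier S /\
  forall x y, x \in E -> y \in E -> x <> y -> e <= rho_n n x y.

Definition max_separated (S : ed_system) (n : nat) (e : R) : \bar R :=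
  ereal_sup [set (#|` E|%fset%:R)%:E | E in separated (S := S) n e].

Definition entropy (S : ed_system) : \bar R :=
  lim (limn_esup (fun n : nat => (n%:R^-1)%:E * lne (max_separated S n e))%E
       @[e --> 0^'+]).

(** * Efficiently discretizable bijections *)

Record ed_bijection (S : ed_system) := EDBijection {
  eb_fun : 'rV[R]_(sp_dim S) -> 'rV[R]_(sp_dim S);
  eb_inv : 'rV[R]_(sp_dim S) -> 'rV[R]_(sp_dim S);
  eb_fun_self : self_map eb_fun;
  eb_inv_self : self_map eb_inv;
  eb_funK : forall x, carrier S x -> eb_inv (eb_fun x) = x;
  eb_invK : forall x, carrier S x -> eb_fun (eb_inv x) = x;
  eb_fun_r : nat -> 'rV[R]_(sp_dim S) -> 'rV[R]_(sp_dim S);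
  eb_inv_r : nat -> 'rV[R]_(sp_dim S) -> 'rV[R]_(sp_dim S);
  eb_fun_eff : exists2 f, polytime f &
    forall r x, (0 < r)%N -> ed_disc S r x -> f (enc r x) = enc r (eb_fun_r r x);
  eb_inv_eff : exists2 f, polytime f &
    forall r x, (0 < r)%N -> ed_disc S r x -> f (enc r x) = enc r (eb_inv_r r x);
  eb_fun_rE : forall r x, (0 < r)%N -> ed_disc S r x -> exists y,
    [/\ carrier S y, (carrier S x -> y = x), (~ carrier S x -> rounds (ed_disc S r) y x) &
        rounds (ed_disc S r) (eb_fun y) (eb_fun_r r x)];
  eb_inv_rE : forall r x, (0 < r)%N -> ed_disc S r x -> exists y,
    [/\ carrier S y, (carrier S x -> y = x), (~ carrier S x -> rounds (ed_disc S r) y x) &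
        rounds (ed_disc S r) (eb_inv y) (eb_inv_r r x)];
  eb_fun_rK : forall r x, (0 < r)%N -> ed_disc S r x ->
    eb_inv_r r (eb_fun_r r x) = x;
  eb_inv_rK : forall r x, (0 < r)%N -> ed_disc S r x ->
    eb_fun_r r (eb_inv_r r x) = x }.

(** * Feasibly queryable maps *)

Definition neighborhood_preserving (S : ed_system) (d : nat)
    (g : forall i, cube d i -> option 'rV[R]_(sp_dim S)) : Prop :=
  forall (i : nat) (x0 : 'rV[R]_d), (0 < i)%N ->
    (forall j, 0 <= x0 ord0 j <= 1) ->
    exists (delta : R) (y0 : 'rV[R]_(sp_dim S)), 0 < delta /\ carrier S y0 /\
      forall x : cube d i,
        dist Euclidean (cube_point x) x0 <= Num.sqrt d%:R / 2 ^+ i <->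
        (if g i x is Some y then rho y y0 <= delta else True).

Record queryable (S : ed_system) := Queryable {
  q_dim : nat;
  q_dim_range : (1 <= q_dim <= sp_dim S)%N;
  q_prec : nat -> nat;
  q_prec_ge : forall i, (0 < i)%N -> (i <= q_prec i)%N;
  q_map : forall i, cube q_dim i -> option 'rV[R]_(sp_dim S);
  q_map_disc : forall i (x : cube q_dim i) y, (0 < i)%N ->
    q_map x = Some y -> ed_disc S (q_prec i) y;
  q_map_nbhd : neighborhood_preserving q_map;
  q_map_eff : exists2 f, polytime f & forall i (x : cube q_dim i), (0 < i)%N ->
    f (enc_cube x) = enc_blank (q_prec i) (q_map x) }.

(** * Telic problems *)

Definition rational_rectangle (m : nat) (a b : 'rV[rat]_m) : set 'rV[R]_m :=
  [set x | forall j, ratr (a ord0 j) <= x ord0 j <= ratr (b ord0 j)].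

(* The total map [H] on [X] with the blank added is [omap] of the bijection
   [tl_bij]. *)
Record telic_data (S : ed_system) := TelicData {
  tl_query : queryable S;
  tl_bij : ed_bijection S;
  tl_commute : forall x, carrier S x ->
    eb_fun tl_bij (ed_map S x) = ed_map S (eb_fun tl_bij x);
  tl_len : nat;
  tl_len_gt0 : (0 < tl_len)%N;
  tl_h : forall i, cube (q_dim tl_query) i -> option 'rV[R]_(sp_dim S) :=
    fun i x => omap (iter tl_len (eb_fun_r tl_bij (q_prec tl_query i)))
                    (q_map x);
  tl_H : word -> word;
  tl_H_eff : polytime tl_H;
  tl_HE : forall i (x : cube (q_dim tl_query) i), (0 < i)%N ->
    tl_H (enc_cube x) = enc_blank (q_prec tl_query i) (tl_h x);
  tl_C : nat;
  tl_C_gt0 : (0 < tl_C)%N;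
  tl_v : nat -> nat := fun n => (tl_C * n)%N;
  tl_V : word -> word;
  tl_V_eff : polytime tl_V;
  tl_VE : forall n, tl_V (unary n) = unary (tl_v n);
  tl_lo : nat -> 'rV[rat]_(sp_dim S);
  tl_hi : nat -> 'rV[rat]_(sp_dim S);
  tl_rect : nat -> set 'rV[R]_(sp_dim S) :=
    fun i => trace (X := S) (rational_rectangle (tl_lo i) (tl_hi i));
  tl_rect_meets : forall i, (0 < i)%N -> tl_rect i !=set0;
  tl_target : nat -> set 'rV[R]_(sp_dim S) :=
    fun i => (iter tl_len (eb_fun tl_bij) @` tl_rect i) `&` carrier S;
  tl_target_n0 : forall i, (0 < i)%N -> tl_target i !=set0;
  tl_B : word -> word;
  tl_B_eff : polytime tl_B;
  tl_BE : forall i x, (0 < i)%N -> ed_disc S (tl_v i) x ->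
    let Bi := [set z | exists2 b, tl_target i b &
                         rounds (ed_disc S (tl_v i)) b z] in
    (Bi x -> tl_B (enc (tl_v i) x) = yes) /\
    (~ Bi x -> tl_B (enc (tl_v i) x) = no) }.

(* A query answered by the blank is not accepted. *)
Definition telic_language (S : ed_system) (D : telic_data S) : language :=
  [set w | exists n, [/\ (0 < n)%N, w = nseq n true &
    exists s : cube (q_dim (tl_query D)) n,
      @tl_h S D n s <> None /\
      tl_B D (ed_machine S (triple (tl_H D (enc_cube s)) (unary n)
                                   (tl_V D (unary n)))) = yes]].

Definition easy (S : ed_system) (D : telic_data S) : Prop :=
  class_P (telic_language D).

Definition hard (S : ed_system) (D : telic_data S) : Prop := ~ easy D.

Definition turing_le (S1 S2 : ed_system) : Prop :=
  forall D1 : telic_data S1, exists D2 : telic_data S2,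
    karp_reduces (telic_language D1) (telic_language D2).

Definition turing_equivalent (S1 S2 : ed_system) : Prop :=
  turing_le S1 S2 /\ turing_le S2 S1.

End Systems.

(* Main.v *)
(* If every telic problem were easy, all telic problems of any two systems that
   have a nonempty telic language would Karp-reduce to each other, so that these
   systems would be Turing equivalent. This applies to the tent map (entropy at
   least log 2 / 4, because of a horseshoe for its square) and to the identity
   (entropy 0) of the unit interval, which contradicts the invariance of
   positive entropy. Since telic languages are in NP, a hard telic problem
   separates P from NP.
   The r-discretization of the interval consists of the odd multiples of 2^-r,
   so that rounding is truncation of a binary expansion not ending in 0s and the
   discretized tent map merely shifts and complements digits. *)
Require Import Defs.
From mathcomp Require Import zify ring lra.
Set Implicit Arguments.
Unset Strict Implicit.
Unset Printing Implicit Defensive.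
Import Order.TTheory GRing.Theory Num.Theory.
Import numFieldNormedType.Exports.

(** * Programs on head-relative tapes *)

(** The tent map doubles distances, so rounding after each iteration would lose a digit per step;
    its discretization has to follow an exact orbit and round once, at the end. Finite binary
    expansions allow this: [k] steps drop [k] digits and complement the remaining ones or not. With
    all multiples of 2^-r, rounding to the nearest one would propagate carries. The odd multiples
    are the midpoints of the intervals of length 2^(1-r) on which the first r - 1 digits are
    constant, and sending ties to the lowest point fits expansions not ending in 0s. They lie in the
    interval, which also spares the choice of a preimage under rounding. Polynomial time refers to
    actual Turing machines. It is shown to be closed under composition and under merging two results
    by a finite one-way transducer; the concrete functions are assembled from these. Programs have
    tapes indexed by arbitrary finite types, so that combining machines means taking sums of index
    types. The decider of an easy language, whose answers are the words 1 and 0, is itself the Karp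
    reduction. *)

(* A tape is read relatively to its head: position [0] is under the head. *)
Definition rtape := int -> cell.

Record prog (I : finType) := Prog {
  pg_state : finType;
  pg_start : pg_state;
  pg_halted : pred pg_state;
  pg_step : pg_state -> {ffun I -> cell} -> pg_state * (I -> cell * direction) }.

(** The tape moves instead of the head: cell [z] of the new frame is cell [z + shift_of a.2] of the
    old one, where the written cell is 0. *)
Definition tape_act (t : rtape) (a : cell * direction) : rtape :=
  fun z => let z' := (z + shift_of a.2)%R in if z' == 0%R then a.1 else t z'.

Definition act (I : finType) (T : I -> rtape) (a : I -> cell * direction) :
  I -> rtape := fun i => tape_act (T i) (a i).

Definition reads (I : finType) (T : I -> rtape) : {ffun I -> cell} :=
  [ffun i => T i 0%R].

Inductive exec (I : finType) (P : prog I) :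
    pg_state P -> (I -> rtape) -> nat -> (I -> rtape) -> Prop :=
| ExecHalt q T : pg_halted q -> exec q T 0 T
| ExecStep q T n T' : ~~ pg_halted q ->
    exec (pg_step q (reads T)).1 (act T (pg_step q (reads T)).2) n T' ->
    exec q T n.+1 T'.

Definition runs (I : finType) (P : prog I) T n T' := exec (pg_start P) T n T'.

Lemma tape_act_stay (t : rtape) : tape_act t (t 0%R, Stay) = t.
Proof.
by apply/funext => z; rewrite /tape_act /= addr0; case: eqP => [->|].
Qed.

Section Sequence.
Variables (I : finType) (P Q : prog I).

Definition seq_step (q : pg_state P + pg_state Q) (r : {ffun I -> cell}) :
    (pg_state P + pg_state Q) * (I -> cell * direction) :=
  match q with
  | inl p => if pg_halted p then (inr (pg_start Q), fun i => (r i, Stay))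
             else (inl (pg_step p r).1, (pg_step p r).2)
  | inr p => (inr (pg_step p r).1, (pg_step p r).2)
  end.

Definition pg_seq : prog I :=
  @Prog I (pg_state P + pg_state Q)%type (inl (pg_start P))
    (fun q => if q is inr p then pg_halted p else false) seq_step.

Lemma exec_seqr q T n T' : exec (P := Q) q T n T' ->
  exec (P := pg_seq) (inr q) T n T'.
Proof.
elim=> {q T n T'} [q T hq|q T n T' hq _ IH]; first exact: ExecHalt.
exact: ExecStep.
Qed.

(** The extra step is the idle move from a halting state of [P] to the start of [Q]; it rewrites
    what it reads. *)
Lemma exec_seql q T n T' m T'' : exec (P := P) q T n T' -> runs Q T' m T'' ->
  exec (P := pg_seq) (inl q) T (n + m).+1 T''.
Proof.
move=> ex rQ; elim: ex rQ => {q T n T'} [q T hq|q T n T' hq _ IH] rQ.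
  apply: ExecStep => //=; rewrite hq /=.
  have -> : act T (fun i => (reads T i, Stay)) = T.
    by apply/funext => i; rewrite /act ffunE tape_act_stay.
  exact: exec_seqr.
by apply: ExecStep => //=; rewrite (negbTE hq); exact: IH.
Qed.

Lemma runs_seq T n T' m T'' : runs P T n T' -> runs Q T' m T'' ->
  runs pg_seq T (n + m).+1 T''.
Proof. exact: exec_seql. Qed.

End Sequence.

Section Embedding.
Variables (I J : finType) (e : I -> J).

Definition embed_act (r : {ffun J -> cell}) (a : I -> cell * direction) (j : J) :
    cell * direction :=
  if [pick i | e i == j] is Some i then a i else (r j, Stay).

Definition embed (P : prog I) : prog J :=
  @Prog J (pg_state P) (pg_start P) (@pg_halted I P)
    (fun q r => let qa := pg_step q [ffun i => r (e i)] in
                (qa.1, embed_act r qa.2)).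

Hypothesis e_inj : injective e.

Lemma exec_embed P q (T : J -> rtape) n T' :
  exec (P := P) q (T \o e) n T' ->
  exists T1, [/\ exec (P := embed P) q T n T1, T1 \o e = T' &
    forall j, (forall i, e i <> j) -> T1 j = T j].
Proof.
move E : (T \o e) => T0 ex; elim: ex T E => {q T0 n T'}
  [q T0 hq|q T0 n T' hq _ IH] T E.
  by exists T; split => //; exact: ExecHalt.
have rE : [ffun i => reads T (e i)] = reads T0.
  by rewrite -E; apply/ffunP => i; rewrite !ffunE.
have [|T1 [ex1 T1E T1n]] := IH (act T (embed_act (reads T) (pg_step q (reads T0)).2)).
  apply/funext => i; rewrite /= /act /embed_act -E.
  by case: pickP => [i' /eqP/e_inj ->|/(_ i)]; rewrite ?eqxx.
exists T1; split => //; first by apply: ExecStep => //=; rewrite rE.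
move=> j nj; rewrite T1n // /act /embed_act.
by case: pickP => [i /eqP/nj|_] //; rewrite ffunE tape_act_stay.
Qed.

End Embedding.

(** * Programs and Turing machines *)

Definition prog_of (M : turing_machine) : prog 'I_(tm_extra M).+1 :=
  @Prog _ (tm_state M) (tm_start M) (@tm_halted M) (@tm_step M).

Definition machine_of k (P : prog 'I_k.+1) : turing_machine :=
  @TuringMachine k (pg_state P) (pg_start P) (@pg_halted _ P) (@pg_step _ P).

Definition relative (M : turing_machine) (c : config M) : 'I_(tm_extra M).+1 -> rtape :=
  fun j z => cf_tape c j (cf_head c j + z)%R.

Lemma relative_step (M : turing_machine) (c : config M) : ~~ tm_halted (cf_state c) ->
  cf_state (step_config c) = (tm_step (cf_state c) (reads (relative c))).1 /\
  relative (step_config c) =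
    act (relative c) (tm_step (cf_state c) (reads (relative c))).2.
Proof.
move=> /negbTE hc; rewrite /step_config hc /=.
have -> : [ffun j => cf_tape c j (cf_head c j)] = reads (relative c).
  by apply/ffunP => j; rewrite !ffunE /relative addr0.
split=> //; apply/funext => j; apply/funext => z.
rewrite /relative /act /tape_act /=.
set s := shift_of _; set h := cf_head c j.
have -> : (h + s + z = h + (z + s))%R by ring.
by rewrite -subr_eq0 addrAC subrr add0r.
Qed.

Definition io_tapes (I : finType) (i0 : I) (w : word) : I -> rtape :=
  fun i => if i == i0 then word_at w else fun=> None.

Lemma relative_init (M : turing_machine) w :
  relative (init_config M w) = io_tapes ord0 w.
Proof.
apply/funext => j; apply/funext => z.
by rewrite /relative /io_tapes /= add0r.
Qed.

(** [halts_with] may observe the machine after it has halted; configurations are frozen from then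
    on, so the true number of steps is at most [t]. *)
Lemma exec_of_halts (M : turing_machine) w t u : halts_with M w t u ->
  exists n T, [/\ (n <= t)%N, runs (prog_of M) (io_tapes ord0 w) n T &
    T ord_max = word_at u].
Proof.
rewrite /halts_with /runs -relative_init /=.
have -> : tm_start M = cf_state (init_config M w) by [].
elim: t (init_config M w) => [|t IH] c /= [hc out].
  exists 0, (relative c); split=> //; first exact: ExecHalt.
  exact/funext.
have [hq|hq] := boolP (tm_halted (cf_state c)).
  exists 0, (relative c); split=> //; first exact: ExecHalt.
  have fixc : step_config c = c by rewrite /step_config hq.
  have fixt : step_config (iter t (@step_config M) c) = c.
    by rewrite -iterS; elim: t {IH hc out} => //= t ->.
  by apply/funext => z; rewrite /relative -out fixt.
have [qE TE] := relative_step hq.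
have [|n [T [nt ex Tout]]] := IH (step_config c).
  by rewrite -!iterSr.
exists n.+1, T; split=> //; apply: ExecStep => //=.
by rewrite -qE -TE.
Qed.

Lemma halts_of_exec (M : turing_machine) w n T u :
  runs (prog_of M) (io_tapes ord0 w) n T -> T ord_max = word_at u ->
  halts_with M w n u.
Proof.
rewrite /halts_with /runs -relative_init /=.
have -> : tm_start M = cf_state (init_config M w) by [].
move: (init_config M w) => c.
move Eq : (cf_state c) => q; move ET : (relative c) => T0 ex.
elim: ex c Eq ET => {q T0 n T} [q T0 hq|q T0 n T hq _ IH] c Eq ET Tout.
  by rewrite /= Eq; split=> // z; rewrite -Tout -ET.
rewrite iterSr; rewrite -Eq in hq.
have [qE TE] := relative_step hq.
by apply: IH => //; rewrite ?qE ?TE ET Eq.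
Qed.

Lemma machine_of_prog (I : finType) (P : prog I) (i0 i1 : I) : i0 <> i1 ->
  exists M : turing_machine, forall w n T u,
    runs P (io_tapes i0 w) n T -> T i1 = word_at u -> halts_with M w n u.
Proof.
move=> ne01; pose k := #|I|.
(* Tape 0 is reserved for the input and tape k + 1 for the output; the other tapes are numbered from
   1 to k by their rank. *)
pose e (i : I) : 'I_k.+2 := if i == i0 then ord0 else
  if i == i1 then ord_max else inord (enum_rank i).+1.
have rk (i : I) : (enum_rank i < k)%N by exact: ltn_ord.
have e0 i : (e i == ord0) = (i == i0).
  rewrite /e; case: (i =P i0) => // _; case: (i =P i1) => // _.
  apply/eqP => /(congr1 val) /=.
  by rewrite inordK // !ltnS ltnW.
have e_inj : injective e.
  move=> i j eij; have := e0 i; rewrite eij e0; move: eij; rewrite /e.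
  case: (i =P i0) => [->|_]; case: (j =P i0) => [->|_] //.
  case: (i =P i1) => [->|_]; case: (j =P i1) => [->|_] //= + _.
  - move=> /(congr1 val) /=; rewrite inordK ?ltnS; last exact: ltnW.
    by case=> E; have := rk j; rewrite -E ltnn.
  - move=> /(congr1 val) /=; rewrite inordK ?ltnS; last exact: ltnW.
    by case=> E; have := rk i; rewrite E ltnn.
  - move=> /(congr1 val) /=; rewrite !inordK ?ltnS; [|exact: ltnW..].
    by move=> -[] /val_inj/enum_rank_inj.
exists (machine_of (embed e P)) => w n T u ex out.
have [|T1 [ex1 T1E _]] := exec_embed e_inj (T := io_tapes ord0 w)
    (q := pg_start P) (n := n) (T' := T).
  suff -> : io_tapes ord0 w \o e = io_tapes i0 w by [].
  by apply/funext => i; rewrite /= /io_tapes e0.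
apply: (@halts_of_exec (machine_of (embed e P)) w n T1 u ex1); rewrite -out -T1E /=; congr T1.
by rewrite /e; case: eqP => [E|_]; [case: ne01|rewrite eqxx].
Qed.

(** * Polynomial bounds *)

(** A base of at least 2 lets the exponent absorb constants and sums, so the closure properties need
    no side condition. *)
Definition poly_bounded (p : nat -> nat) := exists k, forall n, p n <= n.+2 ^ k.

Lemma poly_bounded_le p q : (forall n, p n <= q n) -> poly_bounded q -> poly_bounded p.
Proof. by move=> pq [k qk]; exists k => n; exact: leq_trans (qk n). Qed.

Lemma poly_bounded_cst c : poly_bounded (fun=> c).
Proof. by exists c => n; elim: c => // c IH; rewrite expnS; lia. Qed.

Lemma poly_bounded_id : poly_bounded id.
Proof. by exists 1 => n; rewrite expn1; lia. Qed.

Lemma poly_bounded_add p q : poly_bounded p -> poly_bounded q ->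
  poly_bounded (fun n => p n + q n).
Proof.
move=> [a pa] [b qb]; exists (a + b).+1 => n; have := pa n; have := qb n.
rewrite expnS expnD; have : 0 < n.+2 ^ a by rewrite expn_gt0.
have : 0 < n.+2 ^ b by rewrite expn_gt0.
move: (n.+2 ^ a) (n.+2 ^ b) => x y; nia.
Qed.

Lemma poly_bounded_mul p q : poly_bounded p -> poly_bounded q ->
  poly_bounded (fun n => p n * q n).
Proof. by move=> [a pa] [b qb]; exists (a + b) => n; rewrite expnD leq_mul. Qed.

Lemma poly_bounded_exp p a : poly_bounded p -> poly_bounded (fun n => p n ^ a).
Proof.
move=> pp; elim: a => [|a IH]; first exact: poly_bounded_cst 1.
by apply: poly_bounded_le (poly_bounded_mul pp IH) => n; rewrite expnS.
Qed.

Lemma poly_bounded_comp p q : poly_bounded p -> poly_bounded q ->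
  poly_bounded (p \o q).
Proof.
move=> [a pa] pq; apply: (@poly_bounded_le _ (fun n => (q n + 2) ^ a)) => [n|].
  by rewrite /= addn2.
exact/poly_bounded_exp/poly_bounded_add/poly_bounded_cst.
Qed.

Lemma poly_bounded_polybound c : poly_bounded (polybound c).
Proof.
apply: poly_bounded_add (poly_bounded_cst c); apply: poly_bounded_mul.
  exact: poly_bounded_cst.
exact: poly_bounded_exp poly_bounded_id.
Qed.

Lemma leq_expn2r m n k : m <= n -> m ^ k <= n ^ k.
Proof. by case: k => // k mn; rewrite leq_exp2r. Qed.

Lemma polybound_poly p : poly_bounded p -> exists c, forall n, p n <= polybound c n.
Proof.
(* For n > 0 one has n + 2 <= 3 n; at n = 0 the additive constant takes over, since 2^k <= 3^k. *)
move=> [k pk]; exists (3 ^ k) => n; apply: leq_trans (pk n) _.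
have k3 : k <= 3 ^ k by rewrite ltnW // ltn_expl.
case: n => [|n]; first by apply: leq_trans (leq_addl _ _); exact: leq_expn2r.
apply: leq_trans (leq_addr _ _); apply: (@leq_trans (3 ^ k * n.+1 ^ k)).
  by rewrite -expnMn leq_expn2r //; lia.
by rewrite leq_mul2l leq_pexp2l // orbT.
Qed.

Lemma polybound_mono c : {homo polybound c : m n / m <= n}.
Proof.
by move=> m n mn; rewrite leq_add2r leq_mul2l; rewrite leq_expn2r ?orbT.
Qed.

(** * Polynomial time *)

Lemma polytime_prog (I : finType) (P : prog I) (i0 i1 : I) f p : i0 <> i1 ->
  poly_bounded p ->
  (forall w, exists n T, [/\ n <= p (size w), runs P (io_tapes i0 w) n T &
     T i1 = word_at (f w)]) -> polytime f.
Proof.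
move=> ne01 /polybound_poly[c pc] Pf; have [M HM] := machine_of_prog P ne01.
exists M, c => w; have [n [T [np rn out]]] := Pf w.
by exists n; [exact: leq_trans (pc _)|exact: HM out].
Qed.

Lemma polytime_runs f : polytime f -> exists (M : turing_machine) (c : nat),
  forall w, exists n T, [/\ n <= polybound c (size w),
    runs (prog_of M) (io_tapes ord0 w) n T & T ord_max = word_at (f w)].
Proof.
move=> [M [c Mf]]; exists M, c => w.
have [t tc /exec_of_halts[n [T [nt ex out]]]] := Mf w.
by exists n, T; split=> //; exact: leq_trans tc.
Qed.

(** Seen from the head, the nonblank region grows by at most one cell per step. This is what bounds
    the length of an output by the running time. *)
Lemma exec_support (I : finType) (P : prog I) q T n T' B :
  exec (P := P) q T n T' -> (forall i z, T i z <> None -> `|z| <= B) ->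
  forall i z, T' i z <> None -> `|z| <= B + n.
Proof.
move=> ex; elim: ex B => {q T n T'} [q T _|q T n T' _ _ IH] B TB.
  by rewrite addn0.
rewrite addnS -addSn; apply: IH => i z; rewrite /act /tape_act.
have : `|shift_of (((pg_step q (reads T)).2 i).2)| <= 1 by case: (_.2).
move: (shift_of _) => s s1; case: eqP => [zs _|_ /TB]; lia.
Qed.

Lemma size_output f : polytime f ->
  exists p, poly_bounded p /\ forall w, size (f w) <= p (size w).
Proof.
move=> /polytime_runs[M [c Mf]]; exists (fun n => n + polybound c n + 1); split.
  apply/poly_bounded_add/poly_bounded_cst/poly_bounded_add/poly_bounded_polybound.
  exact: poly_bounded_id.
move=> w; have [n [T [nc ex out]]] := Mf w.
case E : (size (f w)) => [|m] //; rewrite addn1 ltnS.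
have := exec_support (B := size w) ex _ (i := ord_max) (z := m).
rewrite out /= => H; apply: leq_trans (leq_add (leqnn _) nc); apply: H.
  move=> i z; rewrite /io_tapes; case: eqP => // _; case: z => //= k.
  by apply: contra_notT; rewrite -ltnNge => kw; rewrite onth_default // ltnW.
have: m < size (f w) by rewrite E.
by rewrite -onthTE; case: onth.
Qed.

Definition word_from (u : word) (h : int) : rtape := fun z => word_at u (z + h)%R.

Lemma word_from0 u : word_from u 0%R = word_at u.
Proof. by apply/funext => z; rewrite /word_from addr0. Qed.

Lemma tape_act_shift u h d : tape_act (word_from u h) (word_from u h 0%R, d) =
  word_from u (h + shift_of d)%R.
Proof.
apply/funext => z; rewrite /tape_act /word_from /=.
case: eqP => [zE|_]; congr word_at; lia.
Qed.

Lemma word_at_rcons u s : tape_act (word_from u (size u)) (Some s, GoRight) =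
  word_from (rcons u s) (size u).+1.
Proof.
apply/funext => z; rewrite /tape_act /word_from /=.
case: eqP => [zE|nz].
  have -> : (z + (size u).+1%:Z)%R = size u by lia.
  by rewrite /= onthE map_rcons nth_rcons size_map ltnn eqxx.
have -> : (z + 1 + size u = z + (size u).+1%:Z)%R by lia.
case E : (z + (size u).+1%:Z)%R => [k|k] //=.
have nk : k != size u by apply/eqP => kE; apply: nz; lia.
rewrite !onthE map_rcons nth_rcons size_map; case: ltngtP => // ku.
  by rewrite nth_default // size_map ltnW.
by rewrite ku eqxx in nk.
Qed.

(** * Copying a word to another tape *)

Section Copy.
Variables (I : finType) (a b : I).
Hypothesis ab : a <> b.

Let both (r : {ffun I -> cell}) (c : cell) (d : direction) (i : I) : cell * direction :=
  if i == a then (r a, d) else if i == b then (c, d) else (r i, Stay).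

(* [Some false] copies rightwards, [Some true] rewinds, [None] is final. *)
Definition pg_copy : prog I :=
  @Prog I (option bool) (Some false) (pred1 None)
    (fun q r => match q, r a with
       | Some false, Some s => (Some false, both r (Some s) GoRight)
       | Some false, None => (Some true, both r (r b) GoLeft)
       | Some true, Some _ => (Some true, both r (r b) GoLeft)
       | _, _ => (None, both r (r b) GoRight)
       end).

Let act_both T c d : act T (both (reads T) c d) =
  fun i => if i == a then tape_act (T a) (T a 0%R, d)
           else if i == b then tape_act (T b) (c, d) else T i.
Proof.
apply/funext => i; rewrite /act /both !ffunE.
case: eqP => [-> //|_]; case: eqP => [-> //|_].
by rewrite tape_act_stay.
Qed.

Let state (T : I -> rtape) (ta tb : rtape) : I -> rtape :=
  fun i => if i == a then ta else if i == b then tb else T i.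

Let step_state T ta tb c d : act (state T ta tb) (both (reads (state T ta tb)) c d) =
  state T (tape_act ta (ta 0%R, d)) (tape_act tb (c, d)).
Proof.
have Eb : (b == a) = false by apply/eqP => E; apply: ab.
rewrite act_both; apply/funext => i; rewrite /state !eqxx Eb.
by case: (i == a) => //; case: (i == b).
Qed.

Let reads_a T ta tb : reads (state T ta tb) a = ta 0%R.
Proof. by rewrite ffunE /state eqxx. Qed.

Let reads_b T ta tb : reads (state T ta tb) b = tb 0%R.
Proof.
have Eb : (b == a) = false by apply/eqP => E; apply: ab.
by rewrite ffunE /state Eb eqxx.
Qed.

Let copy_back T w k : (k <= size w) ->
  exec (P := pg_copy) (Some true) (state T (word_from w (k%:Z - 1)) (word_from w (k%:Z - 1)))
    k.+1 (state T (word_at w) (word_at w)).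
Proof.
elim: k => [|k IH] kw; apply: ExecStep => //=; rewrite reads_a.
  rewrite {2}/word_from /= step_state reads_b tape_act_shift.
  have -> : (0 - 1 + shift_of GoRight = 0)%R by [].
  by rewrite word_from0; exact: ExecHalt.
have -> : word_from w (k.+1%:Z - 1)%R 0%R = onth w k.
  by rewrite /word_from; have -> : (0 + (k.+1%:Z - 1) = k%:Z)%R by lia.
have : onth w k by rewrite onthTE.
case: (onth w k) => // s _.
rewrite step_state reads_b tape_act_shift /=.
have -> : (k.+1%:Z - 1 - 1 = k%:Z - 1)%R by lia.
exact/IH/ltnW.
Qed.

(** Loop invariant: [u] is already copied and both heads stand at its end. *)
Let copy_forth T u v :
  exec (P := pg_copy) (Some false)
    (state T (word_from (u ++ v) (size u)) (word_from u (size u)))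
    (size v + (size (u ++ v)).+2) (state T (word_at (u ++ v)) (word_at (u ++ v))).
Proof.
elim: v u => [|s v IH] u; apply: ExecStep => //=; rewrite reads_a.
  rewrite cats0 /word_from add0r /= onth_default // step_state reads_b.
  by rewrite !tape_act_shift; exact: copy_back.
rewrite /word_from add0r /= onth_cat ltnn subnn /= step_state tape_act_shift.
by rewrite word_at_rcons -cat_rcons -addn1 -PoszD addn1 -(size_rcons u s); exact: IH.
Qed.

Lemma runs_copy T w : T a = word_at w -> T b = (fun=> None) ->
  exists T', [/\ runs pg_copy T (size w + (size w).+2) T', T' a = word_at w,
    T' b = word_at w & forall i, i <> a -> i <> b -> T' i = T i].
Proof.
move=> Ta Tb; exists (state T (word_at w) (word_at w)).
have Eb : (b == a) = false by apply/eqP => E; apply: ab.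
split; rewrite /state ?Eb ?eqxx //; last by move=> i /eqP/negbTE-> /eqP/negbTE->.
have TE : T = state T (word_from ([::] ++ w) (size ([::] : word)))
                      (word_from [::] (size ([::] : word))).
  apply/funext => i; rewrite /state; case: eqP => [->|_]; first by rewrite word_from0.
  case: eqP => [->|_] //; rewrite Tb word_from0.
  by apply/funext => -[n|n] //=; rewrite onth0n.
by have := copy_forth T [::] w; rewrite -TE.
Qed.

End Copy.

(** * Transducers *)

(* A step gives the next state, tells which of the two one-way input heads move
   right, and the symbol to emit, if any; the device stops on [None]. *)
Record transducer := Transducer {
  td_state : finType;
  td_start : td_state;
  td_step : td_state -> cell -> cell ->
            option (td_state * (bool * bool) * option symbol) }.

Inductive transduces (D : transducer) : td_state D -> word -> word -> word -> nat -> Prop :=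
| TransStop q u v : td_step q (ohead u) (ohead v) = None ->
    transduces q u v [::] 0
| TransStep q u v q' x y e out n :
    td_step q (ohead u) (ohead v) = Some (q', (x, y), e) ->
    transduces q' (if x then behead u else u) (if y then behead v else v) out n ->
    transduces q u v (oapp (cons^~ out) out e) n.+1.

Lemma size_transduces D q u v out n : transduces (D := D) q u v out n -> size out <= n.
Proof.
elim=> {q u v out n} // q u v q' x y e out n _ _ IH.
by case: e => [s|] /=; rewrite ?ltnS // ltnW.
Qed.

Section Transduce.
Variables (I : finType) (D : transducer) (i1 i2 o : I).
Hypotheses (i12 : i1 <> i2) (i1o : i1 <> o) (i2o : i2 <> o).

Let acts (r : {ffun I -> cell}) (d1 d2 : bool) (c : cell) (d : direction) (i : I) :
    cell * direction :=
  if i == o then (c, d) else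
  (r i, if (i == i1) && d1 || (i == i2) && d2 then GoRight else Stay).

(* [Some None] rewinds the output, [None] is final. *)
Definition pg_transduce : prog I :=
  @Prog I (option (option (td_state D))) (Some (Some (td_start D))) (pred1 None)
    (fun q r => match q with
     | Some (Some q) =>
         match td_step q (r i1) (r i2) with
         | Some (q', (x, y), e) => (Some (Some q'), if e is Some s then
             acts r x y (Some s) GoRight else acts r x y (r o) Stay)
         | None => (Some None, acts r false false (r o) GoLeft)
         end
     | _ => if r o is Some _ then (Some None, acts r false false (r o) GoLeft)
            else (None, acts r false false (r o) GoRight)
     end).

(** Only the cells from the head rightwards are constrained: the heads on the inputs never go back,
    so what they leave behind does not matter. *)
Definition reads_as (t : rtape) (u : word) := forall k : nat, t k = onth u k.

Lemma reads_as_act (t : rtape) u (d : bool) : reads_as t u ->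
  reads_as (tape_act t (t 0%R, if d then GoRight else Stay)) (if d then behead u else u).
Proof.
case: d => tu k; last by rewrite tape_act_stay.
rewrite /tape_act /=; have -> : (k%:Z + 1)%R = k.+1 by lia.
by rewrite /= tu; case: u {tu} => //=; rewrite onth0n.
Qed.

Let act_i1 T x y c d : act T (acts (reads T) x y c d) i1 =
  tape_act (T i1) (T i1 0%R, if x then GoRight else Stay).
Proof.
rewrite /act /acts ffunE (negbTE (introN eqP i1o)) eqxx (negbTE (introN eqP i12)).
by rewrite orbF.
Qed.

Let act_i2 T x y c d : act T (acts (reads T) x y c d) i2 =
  tape_act (T i2) (T i2 0%R, if y then GoRight else Stay).
Proof.
rewrite /act /acts ffunE (negbTE (introN eqP i2o)) eqxx.
by rewrite [i2 == _](negbTE (introN eqP (nesym i12))).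
Qed.

Let act_o T x y c d : act T (acts (reads T) x y c d) o = tape_act (T o) (c, d).
Proof. by rewrite /act /acts eqxx. Qed.

(** A word contains no blank, so the first blank met on the way left is the cell just before the
    output. *)
Let rewind T w k : k <= size w -> T o = word_from w (k%:Z - 1)%R ->
  exists T', exec (P := pg_transduce) (Some None) T k.+1 T' /\ T' o = word_at w.
Proof.
elim: k T => [|k IH] T kw To.
  exists (act T (acts (reads T) false false (reads T o) GoRight)).
  rewrite act_o ffunE To tape_act_shift -word_from0; split=> //.
  by apply: ExecStep; rewrite //= ffunE To /word_from /=; exact: ExecHalt.
have [|T' [ex To']] :=
    IH (act T (acts (reads T) false false (reads T o) GoLeft)) (ltnW kw).
  by rewrite act_o ffunE To tape_act_shift; congr word_from => /=; lia.
exists T'; split=> //; apply: ExecStep => //=.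
have -> : reads T o = onth w k.
  rewrite ffunE To /word_from.
  by have -> : (0 + (k.+1%:Z - 1) = k%:Z)%R by lia.
have : onth w k by rewrite onthTE.
case E : (onth w k) => [s|] // _.
suff -> : Some s = reads T o by [].
rewrite ffunE To /word_from -E.
by have -> : (0 + (k.+1%:Z - 1) = k%:Z)%R by lia.
Qed.

Lemma exec_transduce q u v out n T done : transduces (D := D) q u v out n ->
  reads_as (T i1) u -> reads_as (T i2) v -> T o = word_from done (size done) ->
  exists T', exec (P := pg_transduce) (Some (Some q)) T
    (n + (size done + size out).+2) T' /\ T' o = word_at (done ++ out).
Proof.
move=> tr; elim: tr T done => {q u v out n} [q u v st|q u v q' x y e out n st tr IH]
  T done Tu Tv To.
  have Eu : reads T i1 = ohead u by rewrite ffunE (Tu 0); case: u {Tu st}.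
  have Ev : reads T i2 = ohead v by rewrite ffunE (Tv 0); case: v {Tv st}.
  have [|T' [ex To']] := rewind
    (T := act T (acts (reads T) false false (reads T o) GoLeft)) (leqnn (size done)).
    by rewrite act_o ffunE To tape_act_shift.
  rewrite cats0; exists T'; split=> //; rewrite /= addn0.
  by apply: ExecStep => //=; rewrite Eu Ev st.
have Eu : reads T i1 = ohead u by rewrite ffunE (Tu 0); case: u {Tu st tr IH}.
have Ev : reads T i2 = ohead v by rewrite ffunE (Tv 0); case: v {Tv st tr IH}.
pose T1 := act T (if e is Some s then acts (reads T) x y (Some s) GoRight
                  else acts (reads T) x y (reads T o) Stay).
have [|||T' [ex To']] := IH T1 (oapp (rcons done) done e).
- by rewrite /T1; case: (e) => [s|]; rewrite act_i1; exact: reads_as_act.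
- by rewrite /T1; case: (e) => [s|]; rewrite act_i2; exact: reads_as_act.
- rewrite /T1; case: (e) => [s|]; rewrite act_o To /=.
    by rewrite word_at_rcons size_rcons.
  by rewrite ffunE To tape_act_stay.
exists T'; split; last by rewrite To'; case: (e) => [s|] //=; rewrite cat_rcons.
apply: ExecStep => //=; rewrite Eu Ev st /=.
have -> : size done + size (oapp (cons^~ out) out e) =
          size (oapp (rcons done) done e) + size out.
  by case: (e) => [s|] //=; rewrite size_rcons addnS.
exact: ex.
Qed.

Lemma runs_transduce u v out n T : transduces (td_start D) u v out n ->
  reads_as (T i1) u -> reads_as (T i2) v -> T o = (fun=> None) ->
  exists T', runs pg_transduce T (n + (size out).+2) T' /\ T' o = word_at out.
Proof.
move=> tr Tu Tv To; apply: (exec_transduce (done := [::]) tr Tu Tv).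
by rewrite To word_from0; apply/funext => -[k|k] //=; rewrite onth0n.
Qed.

End Transduce.

(** * Closure properties of polynomial time *)

(** The machines work on disjoint tapes, so the second one starts on blank tapes once the
    intermediate word is copied to its input. Copying is sound because an output tape holds nothing
    but the output. *)
Lemma polytime_comp f g : polytime f -> polytime g -> polytime (g \o f).
Proof.
move=> pf /polytime_runs[N [d Ng]]; have [s [/polybound_poly[b sb] fs]] := size_output pf.
have [M [c Mf]] := polytime_runs pf.
pose I := ('I_(tm_extra M).+1 + 'I_(tm_extra N).+1)%type.
pose i0 : I := inl ord0; pose i1 : I := inr ord_max.
pose x : I := inl ord_max; pose y : I := inr ord0.
pose P := pg_seq (embed (inl : _ -> I) (prog_of M))
  (pg_seq (pg_copy x y) (embed (inr : _ -> I) (prog_of N))).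
pose p n := polybound c n + (2 * polybound b n + polybound d (polybound b n) + 4).
apply: (@polytime_prog I P i0 i1 _ p) => //.
  have B := poly_bounded_polybound.
  exact: (poly_bounded_add (B c) (poly_bounded_add (poly_bounded_add
    (poly_bounded_mul (poly_bounded_cst 2) (B b)) (poly_bounded_comp (B d) (B b)))
    (poly_bounded_cst 4))).
move=> w; have [n [T [nc ex out]]] := Mf w.
have [|T1 [ex1 T1E T1n]] := exec_embed (e := inl : _ -> I) inl_inj
    (T := io_tapes i0 w) (q := pg_start (prog_of M)) (n := n) (T' := T).
  rewrite (_ : _ \o _ = io_tapes ord0 w) //.
have [|||T2 [ex2 _ T2y T2n]] := @runs_copy I x y _ T1 (f w) => //.
- by rewrite -out -T1E.
- by rewrite T1n.
have [m [U [md exN outN]]] := Ng (f w).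
have [|T3 [ex3 T3E _]] := exec_embed (e := inr : _ -> I) inr_inj
    (T := T2) (q := pg_start (prog_of N)) (n := m) (T' := U).
  rewrite (_ : _ \o _ = io_tapes ord0 (f w)) //.
  apply/funext => j; rewrite /io_tapes /=; case: eqP => [-> //|j0].
  rewrite T2n //; last by case.
  by rewrite T1n.
exists ((n + (size (f w) + (size (f w)).+2 + m).+1).+1), T3; split.
- have := leq_trans (fs w) (sb (size w)).
  move=> sz; have := leq_trans md (polybound_mono d sz).
  by move: nc sz; rewrite /p; lia.
- exact: runs_seq ex1 (runs_seq ex2 ex3).
- by rewrite /i1 -outN -T3E.
Qed.

Definition linear_transduction (D : transducer) (h : word -> word -> word) :=
  exists c, forall u v, exists2 n, n <= c * (size u + size v).+1 &
    transduces (td_start D) u v (h u v) n.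

(** The input is duplicated, each machine works on its own copy, and the transducer then reads both
    outputs in parallel. Most concrete functions below are instances. *)
Lemma polytime_fork D h f g : linear_transduction D h -> polytime f -> polytime g ->
  polytime (fun w => h (f w) (g w)).
Proof.
move=> [k hk] pf pg.
have [s [/polybound_poly[b sb] fs]] := size_output pf.
have [s' [/polybound_poly[b' sb'] gs]] := size_output pg.
have [M [c Mf]] := polytime_runs pf; have [N [d Ng]] := polytime_runs pg.
pose I := option ('I_(tm_extra M).+1 + 'I_(tm_extra N).+1)%type.
pose e1 j : I := Some (inl j); pose e2 j : I := Some (inr j).
have e1_inj : injective e1 by move=> ? ? [].
have e2_inj : injective e2 by move=> ? ? [].
pose P := pg_seq (pg_copy (e1 ord0) (e2 ord0)) (pg_seq (embed e1 (prog_of M))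
  (pg_seq (embed e2 (prog_of N)) (pg_transduce D (e1 ord_max) (e2 ord_max) None))).
pose p n := 2 * n + (polybound c n + (polybound d n +
  (2 * (k * (polybound b n + polybound b' n + 1)) + 8))).
apply: (@polytime_prog I P (e1 ord0) None _ p) => //.
  have B := poly_bounded_polybound; have C := poly_bounded_cst.
  exact: (poly_bounded_add (poly_bounded_mul (C 2) poly_bounded_id)
    (poly_bounded_add (B c) (poly_bounded_add (B d) (poly_bounded_add
      (poly_bounded_mul (C 2) (poly_bounded_mul (C k)
        (poly_bounded_add (poly_bounded_add (B b) (B b')) (C 1)))) (C 8))))).
move=> w.
have [|||T0 [ex0 T0a T0b T0n]] := @runs_copy I (e1 ord0) (e2 ord0) _ (io_tapes (e1 ord0) w) w => //.
have [n [T [nc ex out]]] := Mf w.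
have [|T1 [ex1 T1E T1n]] := exec_embed e1_inj (T := T0)
    (q := pg_start (prog_of M)) (n := n) (T' := T).
  rewrite (_ : _ \o _ = io_tapes ord0 w) //.
  apply/funext => j; rewrite /io_tapes /=; case: eqP => [-> //|j0].
  rewrite T0n //; last by case.
  by rewrite /io_tapes (inj_eq e1_inj); case: eqP.
have [m [U [md exN outN]]] := Ng w.
have [|T2 [ex2 T2E T2n]] := exec_embed e2_inj (T := T1)
    (q := pg_start (prog_of N)) (n := m) (T' := U).
  rewrite (_ : _ \o _ = io_tapes ord0 w) //.
  apply/funext => j; rewrite /io_tapes /= T1n //; case: eqP => [-> //|j0].
  by rewrite T0n //; case.
have [l lk tr] := hk (f w) (g w).
have Tf : reads_as (T2 (e1 ord_max)) (f w).
  move=> z; rewrite T2n //; have -> : T1 (e1 ord_max) = T ord_max by rewrite -T1E.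
  by rewrite out.
have Tg : reads_as (T2 (e2 ord_max)) (g w).
  by move=> z; rewrite (_ : T2 _ = word_at (g w)) // -outN -T2E.
have To : T2 None = (fun=> None) by rewrite T2n // T1n // T0n.
have [T3 [ex3 T3o]] : exists T3, runs (pg_transduce D (e1 ord_max) (e2 ord_max) None)
    T2 (l + (size (h (f w) (g w))).+2) T3 /\ T3 None = word_at (h (f w) (g w)).
  exact: (runs_transduce _ _ _ tr).
exists ((size w + (size w).+2 + (n + (m + (l + (size (h (f w) (g w))).+2)).+1).+1).+1), T3.
split=> //; last exact: runs_seq ex0 (runs_seq ex1 (runs_seq ex2 ex3)).
have sf := leq_trans (fs w) (sb (size w)); have sg := leq_trans (gs w) (sb' (size w)).
have := size_transduces tr.
have lk' : l <= k * (polybound b (size w) + polybound b' (size w) + 1).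
  by apply: leq_trans lk _; rewrite leq_mul2l; apply/orP; right; lia.
by move: nc md lk'; rewrite /p; lia.
Qed.

Lemma polytime_id : polytime id.
Proof.
pose M := @TuringMachine 0 unit tt xpredT (fun q r => (q, fun=> (None, Stay))).
exists M, 0 => w; exists 0 => //; split=> // z.
by rewrite /= add0r.
Qed.

Lemma polytime_transduction D h f : linear_transduction D (fun u _ => h u) ->
  polytime f -> polytime (fun w => h (f w)).
Proof. by move=> hD pf; exact: (polytime_fork hD pf pf). Qed.

(** * Elementary polynomial-time functions *)

Definition cst_transducer (s : symbol) : transducer :=
  @Transducer bool false (fun q _ _ =>
    if q then None else Some (true, (false, false), Some s)).

Lemma polytime_cst1 s : polytime (fun=> [:: s]).
Proof.
apply: (@polytime_transduction (cst_transducer s) (fun=> [:: s]) id) polytime_id.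
exists 1 => u v; exists 1; first by rewrite mul1n.
by apply: (TransStep (e := Some s) (out := [::])) => //; exact: TransStop.
Qed.

Definition nil_transducer : transducer :=
  @Transducer unit tt (fun _ _ _ => None).

Lemma polytime_nil : polytime (fun=> [::]).
Proof.
apply: (@polytime_transduction nil_transducer (fun=> [::]) id) polytime_id.
by exists 0 => u v; exists 0 => //; exact: TransStop.
Qed.

Definition cat_transducer : transducer :=
  @Transducer bool false (fun q a b => match q, a, b with
    | false, Some s, _ => Some (false, (true, false), Some s)
    | false, None, _ => Some (true, (false, false), None)
    | true, _, Some s => Some (true, (false, true), Some s)
    | true, _, None => None
    end).

Lemma polytime_cat f g : polytime f -> polytime g -> polytime (fun w => f w ++ g w).
Proof.
apply: (@polytime_fork cat_transducer cat).
exists 1 => u v; exists (size u + size v).+1; first by rewrite mul1n.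
elim: u => [|s u IH] /=; last exact: (TransStep (e := Some s)).
apply: (TransStep (e := None)) => //=.
elim: v => [|s v IH] /=; first exact: TransStop.
exact: (TransStep (e := Some s)).
Qed.

Lemma polytime_cst u : polytime (fun=> u).
Proof.
elim: u => [|s u IH]; first exact: polytime_nil.
exact: (polytime_cat (polytime_cst1 s) IH).
Qed.

Lemma polytime_sep f g : polytime f -> polytime g ->
  polytime (fun w => f w ++ None :: g w).
Proof. by move=> pf pg; exact: (polytime_cat pf (polytime_cat (polytime_cst1 None) pg)). Qed.

Definition verdict (b : bool) : word := [:: Some b].

(** One step tests that both words start with the bit 1, the next one that both end there. *)
Definition and_transducer : transducer :=
  @Transducer (option bool) None (fun q a b => match q with
    | None => if (a == Some (Some true)) && (b == Some (Some true))
              then Some (Some true, (true, true), None)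
              else Some (Some false, (false, false), Some (Some false))
    | Some true => Some (Some false, (false, false), Some (Some ((a == None) && (b == None))))
    | Some false => None
    end).

Lemma polytime_and f g : polytime f -> polytime g ->
  polytime (fun w => verdict ((f w == yes) && (g w == yes))).
Proof.
apply: (@polytime_fork and_transducer (fun u v => verdict ((u == yes) && (v == yes)))).
exists 2 => u v.
have emit q u' v' b : @td_step and_transducer q (ohead u') (ohead v') =
    Some (Some false, (false, false), Some (Some b)) ->
  transduces (D := and_transducer) q u' v' (verdict b) 1.
  by move=> st; apply: (TransStep (e := Some (Some b)) (out := [::])) st _; exact: TransStop.
case: (boolP ((ohead u == Some (Some true)) && (ohead v == Some (Some true)))) => [|h].
  case: u v => [|s u] [|s' v]; rewrite ?andbF // => /andP[/eqP[->] /eqP[->]].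
  exists 2; first by rewrite leq_pmulr.
  apply: (TransStep (e := None)) => //=.
  by rewrite !eqseq_cons !eqxx /=; apply: emit; case: u; case: v.
exists 1; first by rewrite muln_gt0.
suff -> : (u == yes) && (v == yes) = false by apply: emit; rewrite /= (negbTE h).
by apply/negP => /andP[/eqP uE /eqP vE]; move: h; rewrite uE vE.
Qed.

Definition ones_transducer : transducer :=
  @Transducer (option bool) None (fun q a _ => match q with
    | Some false => None
    | _ => if a == Some (Some true) then Some (Some true, (true, false), None)
           else Some (Some false, (false, false), Some (Some ((q == Some true) && (a == None))))
    end).

Definition ones (w : word) := (w != [::]) && all (pred1 (Some true)) w.

Lemma polytime_ones f : polytime f -> polytime (fun w => verdict (ones (f w))).
Proof.
apply: (@polytime_transduction ones_transducer (fun w => verdict (ones w))).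
exists 1 => u v; exists (find (predC (pred1 (Some true))) u).+1.
  by rewrite mul1n ltnS (leq_trans (find_size _ _)) // leq_addr.
suff E (q : option bool) : q != Some false ->
  transduces (D := ones_transducer) q u v
    (verdict (((q == Some true) || (u != [::])) && all (pred1 (Some true)) u))
    (find (predC (pred1 (Some true))) u).+1 by exact: (E None).
elim: u q => [|s u IH] q q0 /=.
  apply: (TransStep (D := ones_transducer) (e := Some (Some _)) (out := [::])
    (q' := Some false)); last exact: TransStop.
  by rewrite /= orbF !andbT; case: q q0 => [[]|].
rewrite orbT /=; have [->|s1] := eqVneq s (Some true).
  have := IH (Some true) isT; rewrite /= => tr.
  apply: (@TransStep ones_transducer q (Some true :: u) v _ true false None _ _ _ tr).
  by case: q q0 => [[]|].
apply: (TransStep (D := ones_transducer) (e := Some (Some false)) (out := [::])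
    (q' := Some false)); last exact: TransStop.
have sE : (Some s == Some (Some true)) = false by apply/negbTE.
by rewrite /= sE andbF; case: q q0 => [[]|].
Qed.

Definition nonempty_transducer : transducer :=
  @Transducer bool false (fun q a _ =>
    if q then None else Some (true, (false, false), Some (Some (a != None)))).

Lemma polytime_nonempty f : polytime f -> polytime (fun w => verdict (f w != [::])).
Proof.
apply: (@polytime_transduction nonempty_transducer (fun w => verdict (w != [::]))).
exists 1 => u v; exists 1; first by rewrite mul1n.
apply: (TransStep (e := Some (Some _)) (out := [::]) (D := nonempty_transducer)
  (q' := true)); last exact: TransStop.
by case: u.
Qed.

Fixpoint field (i : nat) (w : word) : word :=
  match w with
  | [::] => [::]
  | None :: w' => if i is i'.+1 then field i' w' else [::]
  | Some b :: w' => if i is 0 then Some b :: field i w' else field i w'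
  end.

Definition field_transducer (i : nat) : transducer :=
  @Transducer 'I_i.+1 ord_max (fun c a _ => match a with
    | None => None
    | Some None => if c == 0 :> nat then None else Some (inord c.-1, (true, false), None)
    | Some (Some b) => Some (c, (true, false), if c == 0 :> nat then Some (Some b) else None)
    end).

Lemma polytime_field i f : polytime f -> polytime (fun w => field i (f w)).
Proof.
apply: (@polytime_transduction (field_transducer i) (field i)).
exists 1 => u v; rewrite mul1n.
suff E (c : 'I_i.+1) : exists2 n, n <= size u &
    transduces (D := field_transducer i) c u v (field c u) n.
  have [n nu tr] := E ord_max; exists n => //.
  by rewrite (leq_trans nu) // ltnW // ltnS leq_addr.
elim: u c => [|[b|] u IH] c.
- by exists 0 => //; exact: TransStop.
- have [n nu tr] := IH c; exists n.+1 => //=.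
  have -> : (if (c : nat) is 0 then Some b :: field c u else field c u) =
    oapp (cons^~ (field c u)) (field c u) (if c == 0 :> nat then Some (Some b) else None).
    by case: (c : nat).
  by apply: (@TransStep (field_transducer i) c (Some b :: u) v c true false _ _ _ _ tr).
have [c0|c0] := eqVneq (c : nat) 0.
  by exists 0 => //=; rewrite c0; apply: TransStop => /=; rewrite c0.
have [n nu tr] := IH (inord c.-1); exists n.+1 => //=.
have cE : (inord c.-1 : 'I_i.+1) = c.-1 :> nat.
  by rewrite inordK // ltnS (leq_trans (leq_pred _)) // -ltnS.
rewrite cE in tr.
have -> : (if (c : nat) is i'.+1 then field i' u else [::]) = field c.-1 u.
  by case: (c : nat) c0.
by apply: (@TransStep (field_transducer i) c (None :: u) v _ true false None _ _ _ tr);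
  rewrite /= (negbTE c0).
Qed.

(** Cutting or completing by 0s, and reading every symbol other than 1 as 0, turns an arbitrary
    certificate into the code of a point of a cube. *)
Definition pad (n : nat) (v : word) : word :=
  mkseq (fun j => Some (if onth v j is Some (Some true) then true else false)) n.

Lemma padS n v : pad n.+1 v =
  Some (if ohead v is Some (Some true) then true else false) :: pad n (behead v).
Proof.
rewrite /pad /mkseq /= -[in iota 1 n](addn0 1) iotaDl -map_comp; congr cons.
by apply: eq_map => j /=; case: v => [|s v] //=; rewrite onth0n.
Qed.

(** The first input is only a clock: its head advances once every [d] output symbols, when the
    counter reaches its end; here [d.-1] is the parameter that the next lemma passes. *)
Definition pad_transducer (d : nat) : transducer :=
  @Transducer 'I_d.+1 ord0 (fun c a b => if a is None then None else
    Some (inord (if c == d :> nat then 0 else c.+1), (c == d :> nat, true),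
          Some (Some (if b is Some (Some true) then true else false)))).

Lemma polytime_pad d f g : (0 < d) -> polytime f -> polytime g ->
  polytime (fun w => pad (d * size (f w)) (g w)).
Proof.
case: d => // d _; apply: (@polytime_fork (pad_transducer d) (fun u v => pad (d.+1 * size u) v)).
exists d.+1 => u v; exists (d.+1 * size u).
  by rewrite leq_mul2l /= ltnW // ltnS leq_addr.
suff E m : forall (c : 'I_d.+1) u v, m + c = d.+1 * size u ->
    transduces (D := pad_transducer d) c u v (pad m v) m.
  by apply: E; rewrite addn0.
elim: m => [|m IH] c [|s {}u] {}v mc.
- exact: TransStop.
- by have := ltn_ord c; move: mc; rewrite /= mulnS; lia.
- by move: mc; rewrite muln0.
rewrite padS; pose c' : 'I_d.+1 := inord (if c == d :> nat then 0 else c.+1).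
apply: (TransStep (D := pad_transducer d) (q' := c') (e := Some (Some _))); first by [].
have mc' : m.+1 + c = d.+1 + d.+1 * size u by rewrite mc mulnS.
apply: IH; rewrite /c'; have := ltn_ord c.
case: eqP => [cd|cd] cl; rewrite inordK //; last by lia.
  by rewrite -[RHS]/(d.+1 * size u); lia.
by rewrite -[RHS]/(d.+1 * (size u).+1) mulnS; lia.
Qed.

(** * Telic languages *)

Lemma field0_sep w r : field 0 (wbits w ++ None :: r) = wbits w.
Proof. by elim: w => //= b w ->. Qed.

Lemma fieldS_sep i w r : field i.+1 (wbits w ++ None :: r) = field i r.
Proof. by elim: w. Qed.

Lemma field0_wbits w : field 0 (wbits w) = wbits w.
Proof. by elim: w => //= b w ->. Qed.

Lemma ones_wbits w : ones (wbits w) <-> exists2 n, 0 < n & w = nseq n true.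
Proof.
split=> [/andP[w0 /allP wt]|[[|n] //= _ ->]]; last first.
  by apply/andP; split=> //=; elim: n.
exists (size w); first by case: w w0 {wt}.
apply/all_pred1P/allP => b bw.
by have /eqP[->] := wt _ (map_f (fun b => Some b : symbol) bw).
Qed.

Lemma pad_wbits n l : pad n (wbits l) = wbits (mkseq (nth false l) n).
Proof.
rewrite /pad /wbits -map_comp; apply: eq_map => j /=; congr Some.
rewrite onth_map -(odflt_onth false) /=; by case: onth => [[]|].
Qed.

Lemma cube_of_bits d n l : size l = d * n ->
  exists s : cube d n, enc_cube s = wbits l.
Proof.
rewrite /enc_cube => sl; suff [s <-] : exists s : cube d n,
  flatten [seq val t | t <- val s] = l by exists s.
elim: d l sl => [|d IH] l sl; first by exists [tuple]; case: l sl.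
have st : size (take n l) == n by rewrite size_takel // sl mulSn leq_addr.
have [|s sE] := IH (drop n l); first by rewrite size_drop sl mulSn addKn.
by exists [tuple of Tuple st :: s]; rewrite /= sE cat_take_drop.
Qed.

Lemma size_enc_cube d n (s : cube d n) : size (enc_cube s) = d * n.
Proof.
rewrite size_map; case: s => l /= /eqP <-.
by elim: l => //= t l IH; rewrite size_cat IH size_tuple mulSn.
Qed.

Lemma enc_neq_nil (R : realType) (m r : nat) (x : 'rV[R]_m) : 0 < m -> enc r x <> [::].
Proof. by case: m x => // m x _; rewrite /enc enum_ordSl. Qed.

Lemma verdictE b : (verdict b == yes) = b.
Proof. by case: b. Qed.

(** The certificate is the bit string of the point [s]. Padding makes every certificate denote some
    point of the cube, so validity need not be checked. A blank answer is recognized by its empty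
    code, since other codes are nonempty in positive dimension. *)
Lemma telic_NP (R : realType) (S : ed_system R) (D : telic_data S) :
  class_NP (telic_language D).
Proof.
pose d := q_dim (tl_query D); have /andP[d0 dm] := q_dim_range (tl_query D).
pose h w := tl_H D (pad (d * size (field 0 w)) (field 1 w)).
pose z w := triple (h w) (field 0 w) (tl_V D (field 0 w)).
pose check w := verdict ((verdict (ones (field 0 w)) == yes) && (verdict (h w != [::]) == yes)).
exists (fun w => verdict ((check w == yes) && (tl_B D (ed_machine S (z w)) == yes))), d.
have p0 : polytime (field 0) by exact: (polytime_field 0 polytime_id).
have ph : polytime h.
  apply: (polytime_comp _ (tl_H_eff D)); apply: polytime_pad => //.
  exact: (polytime_field 1 polytime_id).
split.
  apply: polytime_and.
    by apply: polytime_and; [exact: polytime_ones|exact: polytime_nonempty].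
  apply: (polytime_comp _ (tl_B_eff D)).
  have [eM _ _ _] := ed_machineP S; apply: (polytime_comp _ eM).
  apply: polytime_sep => //; apply: polytime_sep => //.
  exact: (polytime_comp _ (tl_V_eff D)).
have hE n (s : cube d n) : 0 < n -> (tl_H D (enc_cube s) != [::]) = (@tl_h R S D n s != None).
  move=> n0; rewrite tl_HE //; case: tl_h => [y|] //=.
  by apply/eqP/enc_neq_nil/(leq_trans d0 dm).
move=> w; split.
  move=> [n [n0 wE [s [hs Bs]]]]; exists (pmap id (enc_cube s)).
    rewrite size_pmap (leq_trans (count_size _ _)) // size_enc_cube wE size_nseq.
    rewrite (leq_trans _ (leq_addr _ _)) // leq_mul2l -[X in X <= _]expn1.
    by rewrite leq_pexp2l ?orbT.
  have uE : wbits (pmap id (enc_cube s)) = enc_cube s.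
    by rewrite /enc_cube /wbits; elim: (flatten _) => //= b l ->.
  apply/eqP; rewrite verdictE /check !verdictE /z /h field0_sep fieldS_sep field0_wbits uE.
  have pE : pad (d * size (wbits w)) (enc_cube s) = enc_cube s.
    have := size_enc_cube s; rewrite -uE !size_map wE size_nseq pad_wbits => <-.
    by rewrite mkseq_nth.
  rewrite pE hE // wE; apply/andP; split; last exact/eqP.
  by apply/andP; split; [apply/ones_wbits; exists n|apply/eqP].
move=> [u _ /eqP]; rewrite verdictE /check !verdictE /z /h field0_sep fieldS_sep field0_wbits.
move=> /andP[/andP[/ones_wbits[n n0 wE]]]; rewrite pad_wbits size_map wE size_nseq.
have [|s <-] := @cube_of_bits d n (mkseq (nth false u) (d * n)); first by rewrite size_mkseq.
rewrite hE // => /eqP hs /eqP Bs; exists n; split=> //.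
by exists s.
Qed.

(** The deciding function is the reduction: [yes] and [no] are the codes of [[:: true]] and
    [[:: false]]. The former is the unary word 1, the latter is not unary and so lies in no telic
    language. *)
Lemma karp_reduces_nontrivial (L L' : language) : class_P L ->
  L' [:: true] -> ~ L' [:: false] -> karp_reduces L L'.
Proof.
move=> [f pf fL] Lt Lf; exists f => //.
exists (fun w => if `[< L w >] then [:: true] else [:: false]).
  by move=> w; have [fy fn] := fL w; case: asboolP => [/fy|/fn].
by move=> w; case: asboolP.
Qed.

Lemma telic_language_false (R : realType) (S : ed_system R) (D : telic_data S) :
  ~ telic_language D [:: false].
Proof. by case=> -[|[|n]] []. Qed.

Lemma easy_turing_le (R : realType) (S1 S2 : ed_system R) (D2 : telic_data S2) :
  (forall D1 : telic_data S1, easy D1) -> telic_language D2 [:: true] ->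
  turing_le S1 S2.
Proof.
move=> easy1 D2t D1; exists D2; apply: karp_reduces_nontrivial => //; first exact: easy1.
exact: telic_language_false.
Qed.

(** * Symbolic dynamics of the tent map *)

(* [Mid w] stands for the number [0.w1] in base 2, [Top] for 1 and [Bot] for 0. *)
Inductive code := Mid of seq bool | Top | Bot.

(** The tent map on codes. Complementing [w] alone suffices, as 1 - 0.w1 = 0.w'1 for the complement
    w' of w; the exceptional orbit is 1/2, 1, 0, 0, ... *)
Definition next (c : code) : code :=
  match c with
  | Mid (b :: w) => Mid (map (addb b) w)
  | Mid [::] => Top
  | _ => Bot
  end.

(* [digits c] followed by the digit [fill c] forever is the binary expansion of
   [c] that does not end in 0s, except for [Bot]. *)
Definition fill (c : code) : bool := if c is Bot then false else true.
Definition digits (c : code) : seq bool := if c is Mid w then rcons w false else [::].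

Definition truncate (n : nat) (c : code) : seq bool :=
  mkseq (nth (fill c) (digits c)) n.

(** The repeated digit comes first, so that a one-way device knows it before the digits run out. *)
Definition code_word (c : code) : word := wbits (fill c :: digits c).

Definition bit (s : symbol) : bool := s == Some true.

(** One digit is held back in [p], because the last one must be replaced by 0 and is recognized only
    when the input ends. *)
Fixpoint emit_shifted (c p : bool) (u : word) : word :=
  if u is s :: u' then Some (c (+) p) :: emit_shifted c (bit s) u' else [:: Some false].

(* [c] is the last digit skipped: after it the orbit reads the remaining digits
   complemented if [c = 1]. The final digit 1 becomes 0, followed by 1s. *)
Fixpoint shift_digits (c : bool) (u v : word) : word :=
  match v, u with
  | _ :: v', s :: u' => shift_digits (bit s) u' v'
  | _ :: _, [::] => [:: Some false]
  | [::], s :: u' => Some true :: emit_shifted c (bit s) u'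
  | [::], [::] => [:: Some true]
  end.

Definition shift_transducer : transducer :=
  @Transducer (option (bool * option bool)) (Some (false, None)) (fun q a b =>
    match q, a, b with
    | None, _, _ => None
    | Some (c, None), Some s, Some _ => Some (Some (bit s, None), (true, true), None)
    | Some (c, None), None, _ => Some (None, (false, false), Some (Some (b == None)))
    | Some (c, None), Some s, None => Some (Some (c, Some (bit s)), (true, false), Some (Some true))
    | Some (c, Some p), Some s, _ =>
        Some (Some (c, Some (bit s)), (true, false), Some (Some (c (+) p)))
    | Some (c, Some p), None, _ => Some (None, (false, false), Some (Some false))
    end).

Lemma polytime_shift f g : polytime f -> polytime g ->
  polytime (fun w => shift_digits false (f w) (g w)).
Proof.
apply: (@polytime_fork shift_transducer (shift_digits false)).
pose D := shift_transducer.
have last q u v b : td_step (t := D) q (ohead u) (ohead v) =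
    Some (None, (false, false), Some (Some b)) ->
    transduces (D := D) q u v [:: Some b] 1.
  by move=> st; apply: (@TransStep D _ _ _ _ _ _ (Some (Some b)) [::] _ st); exact: TransStop.
have emit c p u v : transduces (D := D) (Some (c, Some p)) u v (emit_shifted c p u) (size u).+1.
  elim: u p => [|s u IH] p; first exact: last.
  exact: (@TransStep D _ (s :: u) v _ true false (Some (Some _)) _ _ _ (IH (bit s))).
exists 2 => u v; suff E c : exists2 n, n <= (size u).+2 &
    transduces (D := D) (Some (c, None)) u v (shift_digits c u v) n.
  by have [n nu tr] := E false; exists n => //; lia.
elim: v u c => [|s' v IH] [|s u] c.
- by exists 1 => //; exact: last.
- exists (size u).+2 => //.
  exact: (@TransStep D _ (s :: u) [::] _ true false (Some (Some true))
    _ _ _ (emit c (bit s) u [::])).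
- by exists 1 => //; exact: last.
have [n nu tr] := IH u (bit s); exists n.+1 => //.
exact: (@TransStep D _ (s :: u) (s' :: v) _ true true None _ _ _ tr).
Qed.

Lemma emit_shiftedE c p l : emit_shifted c p (wbits l) =
  wbits (rcons (map (addb c) (belast p l)) false).
Proof. by elim: l p => //= b l IH p; rewrite IH; case: b. Qed.

Lemma iter_next_Top k : iter k next Top = if k is 0 then Top else Bot.
Proof. by elim: k => // k IH; rewrite iterS IH; case: k {IH}. Qed.

(** Complementations telescope: if the digits are complemented by c and the next one is b, then the
    leading digit is b + c, and dropping it leaves the rest complemented by c + (b + c) = b. *)
Lemma shift_digitsE k w : shift_digits false (wbits (rcons w true)) (unary k) =
  code_word (iter k next (Mid w)).
Proof.
suff E c : shift_digits c (wbits (rcons w true)) (unary k) =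
    code_word (iter k next (Mid (map (addb c) w))).
  by rewrite E (eq_map addFb) map_id.
elim: k w c => [|k IH] w c.
  by case: w => //= b w; rewrite emit_shiftedE belast_rcons; case: b.
case: w => [|b w] /=.
  by rewrite -iterS iterSr iter_next_Top; case: k {IH}.
have -> : bit (Some b) = b by case: b.
rewrite IH -iterS iterSr /=; congr (code_word (iter k next (Mid _))).
by rewrite -map_comp; apply: eq_map => x /=; case: b c x => [] [] [].
Qed.

Definition pick_digits (u v : word) : word :=
  mkseq (fun j => Some (nth (bit (head None u)) (map bit (behead u)) j)) (size v).-1.

Definition pick_transducer : transducer :=
  @Transducer (option bool) None (fun q a b => match q, b with
    | None, _ => Some (Some (bit (odflt None a)), (true, true), None)
    | Some f, None => None
    | Some f, Some _ => Some (Some f, (true, true), Some (Some (if a is Some s then bit s else f)))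
    end).

Lemma mkseqS (T : Type) (f : nat -> T) n : mkseq f n.+1 = f 0 :: mkseq (f \o succn) n.
Proof. by rewrite /mkseq /= -(addn0 1) iotaDl -map_comp. Qed.

Lemma polytime_pick f g : polytime f -> polytime g ->
  polytime (fun w => pick_digits (f w) (g w)).
Proof.
apply: (@polytime_fork pick_transducer pick_digits); pose D := pick_transducer.
exists 1 => u v; exists (size v).-1.+1; first lia.
apply: (@TransStep D _ u v (Some (bit (head None u))) true true None); first by case: u.
suff E b x y : transduces (D := D) (Some b) x y
    (mkseq (fun j => Some (nth b (map bit x) j)) (size y)) (size y).
  by rewrite /pick_digits -size_behead; exact: E.
elim: y x => [|s y IH] x; first exact: TransStop.
rewrite [size _]/= mkseqS (@eq_mkseq _ _ (fun j => Some (nth b (map bit (behead x)) j))).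
  apply: (@TransStep D _ x (s :: y) (Some b) true true (Some (Some _)) _ _ _ (IH (behead x))).
  by case: x.
by move=> j; case: x => //=; rewrite !nth_nil.
Qed.

(** The code of the number 0.l1: positive sign, integer part 0, fractional digits. *)
Definition framed (l : seq bool) : word :=
  [:: Some false; Some false; None] ++ wbits (rcons l true) ++ [:: None].

(** At precision r only r - 1 digits are free: the last digit of an odd multiple of 2^-r is 1. *)
Lemma pick_digitsE c r : 0 < r ->
  framed (truncate r.-1 c) = [:: Some false; Some false; None] ++
    pick_digits (code_word c) (unary r) ++ [:: Some true; None].
Proof.
move=> r0; rewrite /framed /pick_digits /truncate size_map size_nseq /=.
rewrite -cats1 /wbits map_cat -catA; do 3 congr cons; congr cat.
rewrite /mkseq -map_comp; apply: eq_map => j /=; congr Some.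
have bitK : map bit (wbits (digits c)) = digits c.
  by rewrite -map_comp -[RHS]map_id; apply: eq_map; case.
by rewrite bitK; case: c {bitK}.
Qed.

Definition orbit_word (d k r : word) : word :=
  [:: Some false; Some false; None] ++
  pick_digits (shift_digits false d k) r ++ [:: Some true; None].

Lemma polytime_orbit f g h : polytime f -> polytime g -> polytime h ->
  polytime (fun w => orbit_word (f w) (g w) (h w)).
Proof.
move=> pf pg ph; apply: polytime_cat; first exact: polytime_cst.
apply: polytime_cat; last exact: polytime_cst.
by apply: polytime_pick => //; exact: polytime_shift.
Qed.

Lemma orbit_wordE w k r : 0 < r ->
  orbit_word (wbits (rcons w true)) (unary k) (unary r) =
  framed (truncate r.-1 (iter k next (Mid w))).
Proof. by move=> r0; rewrite pick_digitsE // -shift_digitsE. Qed.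

(** * Recognizing the codes of odd multiples *)

Definition odd_transducer : transducer :=
  @Transducer (option (bool + 'I_3)) (Some (inr ord0)) (fun q a _ => match q with
    | None => None
    | Some (inl b) => if a is Some (Some c) then Some (Some (inl c), (true, false), None)
                      else Some (None, (false, false), Some (Some b))
    | Some (inr i) =>
        if a == Some (nth None [:: Some false; Some false; None] i) then
          Some (Some (if i == 2 :> nat then inl false else inr (inord i.+1)), (true, false), None)
        else Some (None, (false, false), Some (Some false))
    end).

Definition bit_framed (b : bool) (p : nat) (l : seq bool) : word :=
  wbits (b :: binary p) ++ None :: wbits l ++ [:: None].

Lemma binary0 : binary 0 = [:: false].
Proof. by []. Qed.

(** A single bit thus tells whether the integer part vanishes. *)
Lemma binary_gt0 p : 0 < p -> exists l, binary p = true :: l.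
Proof.
move=> p0; rewrite /binary /nbits -[(trunc_log 2 p).+1]addn1 iotaD /= map_cat rev_cat /=; eexists.
rewrite add0n; congr cons.
have /andP[lo hi] := trunc_log_bounds (ltnSn 1) p0.
suff -> : p %/ 2 ^ trunc_log 2 p = 1 by [].
by apply/eqP; rewrite eqn_leq -ltnS ltn_divLR ?expn_gt0 // -expnS hi divn_gt0 ?expn_gt0.
Qed.

Lemma transduces_odd b p l v : exists2 n, n <= size l + 4 &
  transduces (td_start odd_transducer) (bit_framed b p l) v
    (verdict [&& ~~ b, p == 0 & last false l]) n.
Proof.
pose D := odd_transducer.
have done q u c : td_step (t := D) q (ohead u) (ohead v) =
    Some (None, (false, false), Some (Some c)) ->
    transduces (D := D) q u v [:: Some c] 1.
  by move=> st; apply: (@TransStep D _ _ _ _ _ _ (Some (Some c)) [::] _ st); exact: TransStop.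
case: b; first by exists 1; [lia|exact: done].
have S1 u o n : transduces (D := D) (Some (inr (inord 1))) u v o n ->
    transduces (td_start D) (Some false :: u) v o n.+1.
  exact: (@TransStep D _ (Some false :: u) v _ true false None).
case: (posnP p) => [->|p0]; last first.
  have [l' E] := binary_gt0 p0; exists 2; first by lia.
  rewrite /bit_framed E /=; apply: S1; apply: done => /=.
  by rewrite inordK.
exists (size l + 4) => //=; rewrite /bit_framed binary0 addn4; apply: S1.
apply: (@TransStep D _ [:: Some false, None & wbits l ++ [:: None]] v
  (Some (inr (inord 2))) true false None).
  by rewrite /= inordK.
apply: (@TransStep D _ [:: None & wbits l ++ [:: None]] v (Some (inl false)) true false None).
  by rewrite /= inordK.
rewrite /=; elim: l false => [|c l IH] b; first exact: done.
exact: (@TransStep D _ (Some c :: (wbits l ++ [:: None])) v (Some (inl c))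
  true false None _ _ _ (IH c)).
Qed.

(** The time must be bounded in terms of the precision alone, although the integer part may be
    arbitrarily long; a bound in the length of the whole code would not do. The machine rejects a
    nonzero integer part at its first bit. *)
Lemma odd_machine : exists M : turing_machine, forall b p l, exists2 t,
  t <= size l + 7 & halts_with M (bit_framed b p l) t
                      (verdict [&& ~~ b, p == 0 & last false l]).
Proof.
pose i1 : 'I_3 := inord 1.
have i01 : ord0 <> i1 by move/(congr1 val); rewrite /= inordK.
have i12 : i1 <> ord_max by move/(congr1 val); rewrite /= inordK.
have i02 : (ord0 : 'I_3) <> ord_max by [].
have [M HM] := machine_of_prog (pg_transduce odd_transducer ord0 i1 ord_max) i02.
exists M => b p l; have [n nl tr] := transduces_odd b p l [::].
have io0 i (w : word) : i <> ord0 :> 'I_3 -> io_tapes ord0 w i = (fun=> None).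
  by move=> /eqP/negbTE; rewrite /io_tapes => ->.
have [|||T [ex out]] := runs_transduce i01 i02 i12 tr
  (T := io_tapes ord0 (bit_framed b p l)).
- by [].
- by move=> k; rewrite io0 ?onth0n //; apply: nesym.
- by rewrite io0.
exists (n + 3); first lia.
exact: HM ex out.
Qed.

(** * Two systems on the unit interval *)

Section Interval.
Variable R : realType.
Local Open Scope classical_set_scope.
Local Open Scope ring_scope.

Definition point (a : R) : 'rV[R]_1 := const_mx a.

Lemma pointK (x : 'rV[R]_1) : point (x ord0 ord0) = x.
Proof. by apply/rowP => j; rewrite mxE !ord1. Qed.

Definition unit_interval : set 'rV[R]_1 := [set x | 0 <= x ord0 ord0 <= 1].

Lemma infinite_unit_interval : infinite_set unit_interval.
Proof.
move=> fin; pose f (n : nat) := point n.+1%:R^-1.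
have f_inj : injective f.
  move=> m n /(congr1 (fun x : 'rV[R]_1 => x ord0 ord0)); rewrite !mxE => /invr_inj /eqP.
  by rewrite eqr_nat => /eqP[].
apply: infinite_nat; apply: sub_finite_set (finite_preimage _ fin) => [n _|]; last first.
  by move=> m n _ _; exact: f_inj.
by rewrite /unit_interval /= mxE invr_ge0 ler0n invf_le1 ?ltr0n // ler1n.
Qed.

Definition interval_space : state_space R :=
  @StateSpace R 1 Euclidean unit_interval infinite_unit_interval
    (fun E => match E with end).

Lemma rho_interval (x y : 'rV[R]_1) :
  rho (X := interval_space) x y = `|x ord0 ord0 - y ord0 ord0|.
Proof. by rewrite /rho /dist big_ord1 /= sqrtr_sqr normr_id. Qed.

Lemma continuous_point : continuous point.
Proof.
move=> a; apply/cvg_ballP => e e0; near=> b; split=> // i j; rewrite !mxE.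
by near: b; apply/nbhs_ballP; exists e.
Unshelve. all: by end_near. Qed.

Lemma unit_intervalE : unit_interval = point @` `[0, 1].
Proof.
apply/seteqP; split=> [x x01|_ [a /= a01 <-]].
  by exists (x ord0 ord0); [rewrite /= in_itv|exact: pointK].
by rewrite /unit_interval /= mxE; rewrite in_itv in a01.
Qed.

Lemma compact_unit_interval : compact unit_interval.
Proof.
rewrite unit_intervalE; apply: continuous_compact; last exact: segment_compact.
exact/continuous_subspaceT/continuous_point.
Qed.

Lemma connected_unit_interval : connected unit_interval.
Proof.
rewrite unit_intervalE; apply: connected_continuous_connected; first exact: segment_connected.
exact/continuous_subspaceT/continuous_point.
Qed.

(** ** The odd multiples of [2^-r] *)

Fixpoint mid (w : seq bool) : R := if w is b :: w' then (b%:R + mid w') / 2 else 2^-1.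

Lemma bits_value_rcons w b : bits_value (rcons w b) = ((bits_value w).*2 + b)%N.
Proof. by rewrite /bits_value foldl_rcons. Qed.

Lemma bits_value_cons b w : bits_value (b :: w) = (b * 2 ^ size w + bits_value w)%N.
Proof.
elim/last_ind: w => [|w c IH]; first by rewrite /bits_value /= muln1 addn0.
by rewrite -rcons_cons !bits_value_rcons IH size_rcons expnS; lia.
Qed.

Lemma bits_value_lt w : (bits_value w < 2 ^ size w)%N.
Proof.
elim/last_ind: w => // w b IH; rewrite bits_value_rcons size_rcons expnS.
by case: b; lia.
Qed.

Lemma nbits_bits_value w : nbits (size w) (bits_value w) = w.
Proof.
rewrite /nbits; apply: (can_inj revK); rewrite revK.
elim/last_ind: w => // w b IH.
rewrite size_rcons rev_rcons bits_value_rcons -IH /= expn0 divn1 oddD odd_double oddb.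
congr cons; rewrite -(addn0 1%N) iotaDl -map_comp; apply: eq_map => i /=.
rewrite add1n expnS divnMA -muln2 divnMDl //.
by rewrite [(b %/ 2)%N]divn_small ?addn0 //; case: (b).
Qed.

Lemma bits_value_nbits r n : (n < 2 ^ r)%N -> bits_value (nbits r n) = n.
Proof.
rewrite /nbits; elim: r n => [|r IH] n nr; first by case: n nr.
rewrite /= rev_cons bits_value_rcons expn0 divn1.
have -> : [seq odd (n %/ 2 ^ i) | i <- iota 1 r] = [seq odd (n./2 %/ 2 ^ i) | i <- iota 0 r].
  rewrite -(addn0 1%N) iotaDl -map_comp; apply: eq_map => i /=.
  by rewrite add1n expnS divnMA divn2.
rewrite IH; last by rewrite expnS in nr; lia.
by rewrite addnC odd_double_half.
Qed.

Lemma size_nbits r n : size (nbits r n) = r.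
Proof. by rewrite size_rev size_map size_iota. Qed.

Lemma mid_value w : mid w * 2 ^+ (size w).+1 = (bits_value (rcons w true))%:R.
Proof.
elim: w => [|b w IH]; first by rewrite /= mulVf.
rewrite rcons_cons bits_value_cons natrD natrM -IH size_rcons natrX.
by rewrite [size _]/= [in LHS]exprS /=; field.
Qed.

Lemma mid_valueE w : mid w = ((bits_value w).*2.+1)%:R / 2 ^+ (size w).+1.
Proof.
by rewrite -addn1 -[1%N]/(true : nat) -bits_value_rcons -mid_value mulfK // expf_neq0.
Qed.

Lemma mid_itv w : 0 < mid w < 1.
Proof. by elim: w => [|b w IH] /=; [lra|case: b; rewrite /= ?mulr1n ?mulr0n; lra]. Qed.

Definition odd_dyadics (r : nat) : set 'rV[R]_1 :=
  [set x | exists2 w, (size w).+1 = r & x = point (mid w)].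

Lemma odd_dyadics_sub r : odd_dyadics r `<=` unit_interval.
Proof.
by move=> _ [w _ ->]; rewrite /unit_interval /= mxE; have := mid_itv w; lra.
Qed.

Lemma enc_point r (x : 'rV[R]_1) : enc r x = enc_coord r (x ord0 ord0).
Proof. by rewrite /enc enum_ordSl enum_ord0 /= cats0. Qed.

Lemma enc_mid w : enc (size w).+1 (point (mid w)) = framed w.
Proof.
rewrite enc_point mxE /enc_coord mid_value.
have -> : Num.floor ((bits_value (rcons w true))%:R : R) = bits_value (rcons w true).
  exact: (@intrKfloor R (bits_value (rcons w true))).
have lt := bits_value_lt (rcons w true); rewrite size_rcons in lt.
rewrite ltNge lez_nat leq0n /= divn_small // modn_small // binary0.
by rewrite -{1}(size_rcons w true) nbits_bits_value.
Qed.

Lemma enc_dyadic r (x : 'rV[R]_1) : dyadic r x -> exists b p l,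
  [/\ size l = r, enc r x = bit_framed b p l &
    (0 < r)%N -> odd_dyadics r x <-> [&& ~~ b, p == 0%N & last false l]].
Proof.
move=> dx; rewrite enc_point /enc_coord; set n := Num.floor _.
have nE : x ord0 ord0 * 2 ^+ r = n%:~R by rewrite /n floorK.
exists (n < 0), (`|n| %/ 2 ^ r)%N, (nbits r (`|n| %% 2 ^ r)); split => // [|r0].
  exact: size_nbits.
split=> [[w sw xE]|].
  have {}nE : n = bits_value (rcons w true).
    by apply/eqP; rewrite -(eqr_int R) -nE xE mxE -sw mid_value.
  have lt := bits_value_lt (rcons w true); rewrite size_rcons sw in lt.
  rewrite nE ltNge lez_nat leq0n /= divn_small // modn_small //.
  by rewrite -{1}sw -(size_rcons w true) nbits_bits_value last_rcons.
case/and3P; rewrite -leNgt => n0 pE lastE.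
have lt : (`|n| < 2 ^ r)%N.
  by move: pE; rewrite -leqn0 -ltnS ltn_divLR ?expn_gt0 // mul1n.
rewrite modn_small // in lastE.
case/lastP E : (nbits r `|n|) lastE => [|w c]; first by [].
rewrite last_rcons => cT; rewrite {c}cT in E.
have sw : (size w).+1 = r by rewrite -(size_rcons w true) -E size_nbits.
exists w => //; rewrite -[LHS]pointK; congr point.
have : x ord0 ord0 * 2 ^+ r = mid w * 2 ^+ r.
  rewrite nE -sw mid_value -E bits_value_nbits //.
  by rewrite -[in LHS](gez0_abs n0).
by apply: mulIf; rewrite expf_neq0.
Qed.

End Interval.

(** * Rounding to odd multiples, and the tent map on codes *)

Section IntervalSystems.
Variable R : realType.
Local Open Scope classical_set_scope.
Local Open Scope ring_scope.

Local Notation mid := (mid R).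
Local Notation X := (interval_space R).
Local Notation odd_dyadics := (@odd_dyadics R).

(** Odd multiples of 2^-r are 2 * 2^-r apart, so a point within 2^-r of one of them is at least as
    close to it as to any other. A tie is lost only at the left end, to the point below, unless
    there is none. *)
Lemma rounds_mid (a : R) w :
  `|a - mid w| <= 2 ^- (size w).+1 ->
  (a = mid w - 2 ^- (size w).+1 -> bits_value w = 0%N) ->
  rounds (X := X) (odd_dyadics (size w).+1) (point a) (point (mid w)).
Proof.
move=> near_w tie_w; split; first by exists w.
move=> _ [w' [sw'] ->]; rewrite !rho_interval !mxE.
rewrite !mid_valueE sw' in near_w tie_w *; set h := 2 ^+ _ in near_w tie_w *.
have h0 : 0 < h by rewrite exprn_gt0.
move: near_w tie_w; set m := bits_value w; set m' := bits_value w' => near_w tie_w.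
(* Multiplication by [h] turns the points into the odd integers [m.*2.+1]. *)
pose A := a * h; have aE : a = A / h by rewrite /A mulfK // gt_eqF.
have normE (b : R) : `|a - b / h| = `|A - b| / h.
  by rewrite aE -mulrBl normrM (@gtr0_norm _ h^-1) // invr_gt0.
rewrite !normE in near_w *.
have {}near_w : `|A - m.*2.+1%:R| <= 1 by move: near_w; rewrite ler_pdivrMr // mulVf ?gt_eqF.
have {}tie_w : A = m.*2%:R -> m = 0%N.
  by move=> E; apply: tie_w; rewrite aE E -natr1 mulrDl mul1r addrK.
rewrite ler_pM2r ?invr_gt0 //.
move: near_w; rewrite -!natr1 -!muln2 !natrM ler_norml => /andP[lo hi].
rewrite -muln2 natrM in tie_w.
case: (ltngtP m' m) => [lt|lt|->].
- have ltr : m'%:R + 1 <= m%:R :> R by rewrite natr1 ler_nat.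
  have -> : `|A - (m'%:R * 2 + 1)| = A - (m'%:R * 2 + 1) by rewrite ger0_norm //; lra.
  split; first by rewrite ler_norml; lra.
  have hV0 : h^-1 != 0 by rewrite invr_eq0 gt_eqF.
  have nle : `|A - (m%:R * 2 + 1)| <= 1 by rewrite ler_norml; lra.
  move=> /(mulIf hV0) E; rewrite (_ : m = 0%N) // in lt.
  by apply: tie_w; lra.
- have ltr : m%:R + 1 <= m'%:R :> R by rewrite natr1 ler_nat.
  have -> : `|A - (m'%:R * 2 + 1)| = - (A - (m'%:R * 2 + 1)) by rewrite ler0_norm //; lra.
  split; first by rewrite ler_norml; lra.
  move=> _; right; exists ord0; split; last by case.
  by rewrite !mxE ltr_pM2r ?invr_gt0 //; lra.
- by split => // _; left.
Qed.

Definition tent (a : R) : R := if a <= 2^-1 then 2 * a else 2 - 2 * a.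

Definition tent_map (x : 'rV[R]_1) : 'rV[R]_1 := point (tent (x ord0 ord0)).

Definition value (c : code) : R := match c with Mid w => mid w | Top => 1 | Bot => 0 end.

Lemma mid_negb w : mid (map negb w) = 1 - mid w.
Proof. by elim: w => [|b w IH] /=; [lra|rewrite IH; case: b; rewrite /= ?mulr1n ?mulr0n; lra]. Qed.

Lemma tent_value c : tent (value c) = value (next c).
Proof.
rewrite /tent; case: c => [[|b w]||].
- by rewrite /= lexx; lra.
- have /andP[w0 w1] := mid_itv R w; case: b.
    have nE : next (Mid (true :: w)) = Mid (map negb w) by [].
    by rewrite nE [value (Mid (map _ _))]/= mid_negb /= mulr1n; case: leP => h; lra.
  by rewrite /= map_id mulr0n; case: leP => h; lra.
- by rewrite /=; case: leP => h; lra.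
- by rewrite /=; case: leP => h; lra.
Qed.

Lemma iter_tent_map k c : iter k tent_map (point (value c)) = point (value (iter k next c)).
Proof. by elim: k => // k IH; rewrite !iterS IH /tent_map mxE tent_value. Qed.

(* The value of the digits [l] followed by 1s. *)
Fixpoint upper (l : seq bool) : R := if l is b :: l' then (b%:R + upper l') / 2 else 1.

Lemma upper_mid w : upper (rcons w false) = mid w.
Proof. by elim: w => [|b w IH] /=; [lra|rewrite IH]. Qed.

Lemma upper_itv l : 0 < upper l <= 1.
Proof. by elim: l => [|b l IH] /=; [lra|case: b; rewrite /= ?mulr1n ?mulr0n; lra]. Qed.

(** The lower bound is strict because the expansion continues with 1s, so [upper] is positive on
    every tail. This excludes ties with the point below. *)
Lemma upper_truncate n l :
  mid (mkseq (nth true l) n) - 2 ^- n.+1 < upper l <= mid (mkseq (nth true l) n) + 2 ^- n.+1.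
Proof.
elim: n l => [|n IH] l; first by have := upper_itv l; rewrite /= expr1; lra.
have := IH (behead l); rewrite mkseqS (@eq_mkseq _ _ (nth true (behead l))); last first.
  by move=> i; case: l => //=; rewrite nth_nil.
rewrite [2 ^+ n.+2]exprSr invfM /=.
suff -> : upper l = ((nth true l 0)%:R + upper (behead l)) / 2 by lra.
by case: l => //=; rewrite mulr1n; lra.
Qed.

Lemma truncate_Bot n : truncate n Bot = nseq n false.
Proof.
by apply: (@eq_from_nth _ false) => [|i]; rewrite size_mkseq ?size_nseq // => ni;
  rewrite nth_mkseq // nth_nil nth_nseq ni.
Qed.

Lemma mid_zeros n : mid (nseq n false) = 2 ^- n.+1.
Proof. by elim: n => [|n IH] //; rewrite [2 ^+ n.+2]exprSr invfM /= IH; lra. Qed.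

Lemma bits_value_zeros n : bits_value (nseq n false) = 0%N.
Proof. by elim: n => // n IH; rewrite /= bits_value_cons IH. Qed.

(** The kept digits followed by 1 give the midpoint of the interval of numbers with these digits.
    The right end belongs to this interval, in accordance with the tie rule; the left end occurs
    only for [Bot], below which there is no point. *)
Lemma rounds_truncate r c : (0 < r)%N ->
  rounds (X := X) (odd_dyadics r) (point (value c)) (point (mid (truncate r.-1 c))).
Proof.
case: r => // n _ /=; set w := truncate n c.
have sw : (size w).+1 = n.+1 by rewrite size_mkseq.
have e0 : 0 < 2 ^- n.+1 :> R by rewrite invr_gt0 exprn_gt0.
rewrite -[X in odd_dyadics X]sw; apply: rounds_mid; rewrite sw.
  case: c @w {sw} => [v||] w /=.
  - by have := upper_truncate n (rcons v false); rewrite upper_mid ler_norml -/w; lra.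
  - by have := upper_truncate n [::]; rewrite /= ler_norml -/w; lra.
  - by rewrite /w truncate_Bot mid_zeros sub0r normrN gtr0_norm.
case: c @w {sw} => [v||] w /= E.
- by exfalso; have := upper_truncate n (rcons v false); rewrite upper_mid -/w; lra.
- by exfalso; have := upper_truncate n [::]; rewrite /= -/w; lra.
- by rewrite /w truncate_Bot bits_value_zeros.
Qed.

Lemma odd_dyadics_dense r x : (0 < r)%N -> unit_interval x ->
  exists2 z, odd_dyadics r z & rho (X := X) x z <= 2 ^- r.
Proof.
case: r => // n _; rewrite /unit_interval /=; set a := x _ _ => a01.
suff [w sw aw] : exists2 w, size w = n & `|a - mid w| <= 2 ^- n.+1.
  by exists (point (mid w)); [exists w; rewrite ?sw|rewrite rho_interval mxE].
elim: n a a01 => [|n IH] a a01.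
  by exists [::]; rewrite //= expr1 ler_norml; lra.
have [ah|ah] := leP a 2^-1.
  have [|w sw aw] := IH (2 * a); first lra.
  exists (false :: w); first by rewrite /= sw.
  by move: aw; rewrite [2 ^+ n.+2]exprSr invfM !ler_norml /=; lra.
have [|w sw aw] := IH (2 * a - 1); first lra.
exists (true :: w); first by rewrite /= sw.
by move: aw; rewrite [2 ^+ n.+2]exprSr invfM !ler_norml /=; lra.
Qed.

End IntervalSystems.

(** * Discretized systems on the interval and a telic problem *)

Section TelicInterval.
Variable R : realType.
Local Open Scope classical_set_scope.
Local Open Scope ring_scope.

Local Notation mid := (mid R).
Local Notation X := (interval_space R).
Local Notation odd_dyadics := (@odd_dyadics R).

Lemma efficient_odd_dyadics : efficient_discretization (X := X) odd_dyadics.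
Proof.
split=> [r r0|].
  split=> [_ [w sw ->] j|//|x]; last exact: odd_dyadics_dense.
  by rewrite mxE -sw mid_value natr_int.
have [M HM] := odd_machine; exists M, 7%N => r x r0 /enc_dyadic[b [p [l [sl -> oE]]]].
have [t tl ht] := HM b p l; exists t.
  apply: leq_trans tl _; rewrite sl /polybound leq_add2r -[X in (X <= _)%N]expn1.
  apply: (@leq_trans (r ^ 7)); last by rewrite leq_pmull.
  by rewrite leq_pexp2l.
rewrite (_ : (if _ then _ else _) = verdict [&& ~~ b, p == 0%N & last false l]) //.
case: asboolP => [/(oE r0)->//|nD]; case E : [&& _, _ & _] => //.
by case: nD; apply/(oE r0).
Qed.

(** Since all discretizations lie in the interval, the orbit starts at the given point [Mid w]
    itself and is followed exactly on codes; the clause on preimages under rounding is vacuous. *)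
Lemma map_discretization_code (T : 'rV[R]_1 -> 'rV[R]_1) (step : code -> code)
    (MT : word -> word) :
  polytime MT ->
  (forall w k r, (0 < r)%N -> MT (triple (framed w) (unary k) (unary r)) =
     framed (truncate r.-1 (iter k step (Mid w)))) ->
  (forall k c, iter k T (point (value R c)) = point (value R (iter k step c))) ->
  map_discretization (X := X) T odd_dyadics MT.
Proof.
move=> pMT MTE TE.
have encE r c : (0 < r)%N -> framed (truncate r.-1 c) = enc r (point (mid (truncate r.-1 c))).
  by case: r => // r _; rewrite -(enc_mid R) size_mkseq.
have D r c : (0 < r)%N -> odd_dyadics r (point (mid (truncate r.-1 c))).
  by case: r => // r _; exists (truncate r c); rewrite ?size_mkseq.
split=> // [s k r x s0 r0 [w <- ->]|_ s k r x s0 r0 [w <- ->]|[]].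
- rewrite enc_mid MTE // encE //; exists r, (point (mid (truncate r.-1 (iter k step (Mid w))))).
  by split=> //; exact: D.
- exists (point (mid (truncate r.-1 (iter k step (Mid w))))).
    by rewrite (TE k (Mid w)); exact: rounds_truncate.
  by rewrite enc_mid MTE // encE.
by move=> r _; exact: odd_dyadics_sub.
Qed.

Lemma field1_triple w a b : field 1 (triple (framed w) a b) = wbits (rcons w true).
Proof. by rewrite /triple /framed /= -!catA field0_sep. Qed.

(** Field 2 is empty: the separator closing [framed] is followed by that of [triple]. *)
Lemma field3_triple w k r : field 3 (triple (framed w) (unary k) (unary r)) = unary k.
Proof. by rewrite /triple /framed /= -!catA fieldS_sep /= field0_sep. Qed.

Lemma field4_triple w k r : field 4 (triple (framed w) (unary k) (unary r)) = unary r.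
Proof. by rewrite /triple /framed /= -!catA fieldS_sep /= fieldS_sep field0_wbits. Qed.

Lemma tent_map_discretization : map_discretization (X := X) (@tent_map R) odd_dyadics
  (fun w => orbit_word (field 1 w) (field 3 w) (field 4 w)).
Proof.
apply: (@map_discretization_code _ next) => [|w k r r0|k c]; last exact: iter_tent_map.
  by apply: polytime_orbit; exact: (polytime_field _ polytime_id).
by rewrite field1_triple field3_triple field4_triple orbit_wordE.
Qed.

(** The identity is the tent machine run for 0 steps, [[::]] being [unary 0]. *)
Lemma id_map_discretization : map_discretization (X := X) id odd_dyadics
  (fun w => orbit_word (field 1 w) [::] (field 4 w)).
Proof.
have idE (T : Type) k (x : T) : iter k id x = x by elim: k.
apply: (@map_discretization_code _ id) => [|w k r r0|k c]; last by rewrite !idE.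
  apply: polytime_orbit; [|exact: polytime_nil|]; exact: (polytime_field _ polytime_id).
by rewrite field1_triple field4_triple idE (@orbit_wordE w 0).
Qed.

Lemma tent_itv (a : R) : 0 <= a <= 1 -> 0 <= tent a <= 1.
Proof. by rewrite /tent; case: (leP a 2^-1) => h; lra. Qed.

Lemma tent_self : self_map (X := X) (@tent_map R).
Proof. by move=> x x01; rewrite /= /unit_interval /= mxE; exact: tent_itv. Qed.

Lemma id_self : self_map (X := X) id.
Proof. by []. Qed.

Definition interval_system T (selfT : self_map (X := X) T) MT
    (MTP : map_discretization (X := X) T odd_dyadics MT) : ed_system R :=
  EDSystem selfT efficient_odd_dyadics MTP.

Section Telic.
Variables (T : 'rV[R]_1 -> 'rV[R]_1) (selfT : self_map (X := X) T) (MT : word -> word).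
Hypothesis MTP : map_discretization (X := X) T odd_dyadics MT.
Local Notation S := (interval_system selfT MTP).

(** A final digit 1 is appended to the [i] bits of a cube point, so that the image is an odd
    multiple at precision [i.+1]. *)
Definition cube_mid (i : nat) (s : cube 1 i) : option 'rV[R]_1 :=
  Some (point (mid (tnth s ord0))).

Lemma cube_mid_disc i (s : cube 1 i) y : (0 < i)%N -> cube_mid s = Some y ->
  odd_dyadics i.+1 y.
Proof. by move=> _ [<-]; exists (tnth s ord0); rewrite ?size_tuple. Qed.

(* The ball of radius [2^-i] around [x0] is moved by [2^-(i+1)] to the right and
   its center is kept in [[0, 1]]. *)
Lemma cube_mid_nbhd : neighborhood_preserving (S := S) cube_mid.
Proof.
move=> i x0 i0 /(_ ord0); set a := x0 _ _ => a01.
pose e : R := 2 ^- i; have e0 : 0 < e by rewrite invr_gt0 exprn_gt0.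
exists e, (point (Num.min (a + e / 2) 1)); split=> //; split.
  by rewrite /= /unit_interval /= mxE le_min ge_min lexx orbT; lra.
move=> s; rewrite /cube_mid rho_interval !mxE /dist big_ord1 /= sqrtr_sqr normr_id sqrtr1 mul1r.
rewrite !mxE -/a -/e mid_valueE size_tuple.
have := bits_value_lt (tnth s ord0); rewrite size_tuple; set m := bits_value _ => m2.
have -> : m.*2.+1%:R / 2 ^+ i.+1 = m%:R * e + e / 2.
  rewrite exprS invfM -/e -natr1 -muln2 natrM; lra.
have eE : (2 ^ i)%:R * e = 1 by rewrite natrX mulfV // expf_neq0.
(* If the center is clipped to 1, then [a > 1 - e / 2], and both balls contain exactly the last grid
   point, [m = 2 ^ i - 1]. *)
have [mE|mE] : (m.+1 = 2 ^ i \/ m.+2 <= 2 ^ i)%N by lia.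
  have {}mE : m%:R * e = 1 - e by move: eE; rewrite -mE -natr1 mulrDl mul1r; lra.
  rewrite mE minElt; case: ifP => h; rewrite !ler_norml; split; lra.
have {}mE : m%:R * e <= 1 - 2 * e.
  have : m.+2%:R * e <= (2 ^ i)%:R * e by rewrite ler_pM2r ?ler_nat.
  by rewrite eE -addn2 natrD; lra.
have m0 : 0 <= m%:R * e by rewrite mulr_ge0 ?ler0n // ltW.
rewrite minElt; case: ifP => h; rewrite !ler_norml; split; lra.
Qed.

Lemma cube_mid_eff : exists2 f, polytime f & forall i (s : cube 1 i), (0 < i)%N ->
  f (enc_cube s) = enc_blank i.+1 (cube_mid s).
Proof.
exists (fun w => [:: Some false; Some false; None] ++ w ++ [:: Some true; None]).
  apply: polytime_cat; first exact: polytime_cst.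
  by apply: polytime_cat; [exact: polytime_id|exact: polytime_cst].
move=> i s _; rewrite /= -{2}(size_tuple (tnth s ord0)) enc_mid /framed -cats1 /wbits map_cat -catA.
congr (_ :: _ :: _ :: (_ ++ _)); rewrite /enc_cube; case/tupleP: s => t s.
by rewrite tuple0 /= cats0 (tnth_nth t).
Qed.

Definition interval_query : queryable S :=
  @Queryable R S 1 isT succn (fun i _ => leqnSn i) cube_mid cube_mid_disc
    cube_mid_nbhd cube_mid_eff.

Lemma rounds_refl r x : odd_dyadics r x -> rounds (X := X) (odd_dyadics r) x x.
Proof.
move=> [w <- ->]; have e0 : 0 < 2 ^- (size w).+1 :> R by rewrite invr_gt0 exprn_gt0.
by apply: rounds_mid => [|E]; [rewrite subrr normr0 ltW|exfalso; lra].
Qed.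

Let id_eff : exists2 f, polytime f & forall r x, (0 < r)%N -> odd_dyadics r x ->
  f (enc r x) = enc r x.
Proof. by exists id; [exact: polytime_id|]. Qed.

Let id_rE r x : (0 < r)%N -> odd_dyadics r x -> exists y,
  [/\ unit_interval y, (unit_interval x -> y = x),
      (~ unit_interval x -> rounds (X := X) (odd_dyadics r) y x) &
      rounds (X := X) (odd_dyadics r) y x].
Proof.
move=> _ xr; have xx := rounds_refl xr; exists x; split=> //.
exact: odd_dyadics_sub xr.
Qed.

Definition id_bijection : ed_bijection S :=
  @EDBijection R S id id (fun _ h => h) (fun _ h => h) (fun _ _ => erefl) (fun _ _ => erefl)
    (fun=> id) (fun=> id) id_eff id_eff id_rE id_rE
    (fun _ _ _ _ => erefl) (fun _ _ _ _ => erefl).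

(** With the whole interval as target, the constant answer [yes] is correct, and every nonempty
    unary word is accepted. *)
Lemma interval_telic : exists D : telic_data S, telic_language D [:: true].
Proof.
have [f pf fE] := cube_mid_eff.
have in_rect x : unit_interval x ->
    trace (X := X) (@rational_rectangle R 1 (const_mx 0) (const_mx 1)) x.
  by move=> x01; split=> // j; rewrite !mxE rmorph0 rmorph1 (ord1 j); exact: x01.
have x01 : unit_interval (point (0 : R)).
  by rewrite /unit_interval /= mxE lexx ler01.
unshelve eexists (@TelicData R S interval_query id_bijection (fun _ _ => erefl) 1 isT
  f pf _ 1 isT id polytime_id _ (fun=> const_mx 0) (fun=> const_mx 1) _ _
  (fun=> yes) (polytime_cst1 _) _) => /=.
- by move=> i x i0; rewrite fE.
- by move=> n; rewrite mul1n.
- by move=> i i0; exists (point 0); exact: in_rect.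
- by move=> i i0; exists (point 0); split=> //; exists (point 0) => //; exact: in_rect.
- move=> i x i0 xr; split=> // -[]; exists x; last exact: rounds_refl.
  have xu := odd_dyadics_sub xr; split=> //; exists x => //; exact: in_rect.
- by exists 1%N; split=> //; exists [tuple [tuple false]].
Qed.

End Telic.

Definition tent_system : ed_system R := interval_system tent_self tent_map_discretization.

Definition id_system : ed_system R := interval_system id_self id_map_discretization.

End TelicInterval.

(** * Entropy *)

Section Entropy.
Variable R : realType.
Local Open Scope classical_set_scope.
Local Open Scope ring_scope.

Lemma limn_esup_le (u : nat -> \bar R) N M :
  (forall n, (N <= n)%N -> (u n <= M)%E) -> (limn_esup u <= M)%E.
Proof.
move=> uM; apply: (@le_trans _ _ (ereal_sup (u @` [set n | (N <= n)%N]))).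
  by apply: ereal_inf_lbound; exists [set n | (N <= n)%N] => //; exists N.
by apply: ge_ereal_sup => _ [n Nn <-]; exact: uM.
Qed.

Lemma le_limn_esup (u v : nat -> \bar R) N :
  (forall n, (N <= n)%N -> (u n <= v n)%E) -> (limn_esup u <= limn_esup v)%E.
Proof.
move=> uv; apply: le_ereal_inf_tmp => _ [A [m _ mA] <-].
apply: (@le_trans _ _ (ereal_sup (u @` [set n | (maxn N m <= n)%N]))).
  apply: ereal_inf_lbound; exists [set n | (maxn N m <= n)%N] => //.
  by exists (maxn N m).
apply: ge_ereal_sup => _ [n /= nNm <-]; move: nNm; rewrite geq_max => /andP[Nn mn].
apply: le_trans (uv _ Nn) _; apply: ereal_sup_ubound; exists n => //.
exact: mA.
Qed.

Lemma limn_esup_ge (u : nat -> \bar R) N M :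
  (forall n, (N <= n)%N -> (M <= u n)%E) -> (M <= limn_esup u)%E.
Proof.
move=> uM; apply: le_ereal_inf_tmp => _ [A [m _ mA] <-].
apply: le_trans (uM _ (leq_maxl N m)) _; apply: ereal_sup_ubound.
by exists (maxn N m) => //; apply: mA; rewrite /= leq_maxr.
Qed.

Variable S : ed_system R.

Definition growth (e : R) : \bar R :=
  limn_esup (fun n : nat => (n%:R^-1)%:E * lne (max_separated S n e))%E.

Lemma max_separated_ge0 n e : (0 <= max_separated S n e)%E.
Proof.
apply: ereal_sup_ubound; exists fset0; last by rewrite cardfs0.
by split=> [x|x y] //=; rewrite inE.
Qed.

Lemma lne_mono (x y : \bar R) : (0 <= x)%E -> (x <= y)%E -> (lne x <= lne y)%E.
Proof.
move=> x0 xy; rewrite lee_lne // in_itv /= leey andbT //.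
exact: le_trans xy.
Qed.

Lemma growth_nonincreasing e1 e2 : e1 <= e2 -> (growth e2 <= growth e1)%E.
Proof.
move=> e12; apply: (@le_limn_esup _ _ 0) => n _; apply: lee_wpmul2l.
  by rewrite lee_fin invr_ge0 ler0n.
apply: lne_mono; first exact: max_separated_ge0.
apply: ereal_sup_le => _ [E [sE dE] <-]; exists E => //; split=> // x y xE yE xy.
exact: le_trans e12 (dE _ _ xE yE xy).
Qed.

(** Smaller [e] allow more separated sets, so the limit at 0 is a supremum: a lower bound on entropy
    needs only one value of [e]. *)
Lemma entropyE : entropy S = ereal_sup (growth @` [set e | 0 < e]).
Proof.
have := @nonincreasing_at_right_cvge _ growth 0 (BInfty _ false) isT.
have -> : [set` Interval (BRight (0 : R)) (BInfty _ false)] = [set e | 0 < e].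
  by apply/seteqP; split => e /=; rewrite in_itv /= andbT.
move=> /(_ _)/cvg_lim; apply => // e1 e2 _ _; exact: growth_nonincreasing.
Qed.

End Entropy.

(** * Entropy of the identity and of the tent map *)

Section TentEntropy.
Variable R : realType.
Local Open Scope classical_set_scope.
Local Open Scope ring_scope.

(** Under the identity [rho_n] never exceeds the distance, so a separated set has at most one point
    in each half-open interval of length [e], whatever [n] is. *)
Lemma entropy_id_le0 : (entropy (id_system R) <= 0)%E.
Proof.
rewrite entropyE; apply: ge_ereal_sup => _ [e /= e0 <-].
pose K := (Num.truncn e^-1).+1.
have sepK n : (0 < n)%N -> (max_separated (id_system R) n e <= K%:R%:E)%E.
  move=> n0; apply: ge_ereal_sup => _ [E [sE dE] <-]; rewrite lee_fin ler_nat.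
  pose f (x : 'rV[R]_1) := Num.truncn (x ord0 ord0 / e).
  have f_inj : {in E &, injective f}.
    move=> x y xE yE fxy; apply/eqP/negPn/negP => /eqP xy.
    have : e <= `|x ord0 ord0 - y ord0 ord0|.
      apply: le_trans (dE _ _ xE yE xy) _; apply: bigmax_le => // i _.
      by rewrite rho_interval; elim: (i : nat) => // k; rewrite !iterS.
    have /andP[x0 _] := sE _ xE; have /andP[y0 _] := sE _ yE.
    have := @truncn_itv _ (x ord0 ord0 / e) (divr_ge0 x0 (ltW e0)).
    have := @truncn_itv _ (y ord0 ord0 / e) (divr_ge0 y0 (ltW e0)).
    rewrite -/(f x) -/(f y) fxy -!natr1 !ler_pdivlMr // !ltr_pdivrMr //.
    by rewrite ler_normr => /andP[? ?] /andP[? ?] /orP[]; nra.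
  rewrite -(size_map f) -(size_iota 0 K); apply: uniq_leq_size.
    by rewrite map_inj_in_uniq ?fset_uniq.
  move=> _ /mapP[x xE ->]; rewrite mem_iota /= ltnS le_truncn //.
  have /andP[_ x1] := sE _ xE.
  by rewrite ler_pdivrMr // mulVf // gt_eqF.
apply/lee_addgt0Pr => eps eps0; rewrite add0e.
(* [K] is independent of [n], so [ln K / n <= eps] from this rank on. *)
apply: (@limn_esup_le _ _ (Num.truncn (ln K%:R / eps)).+1) => n nN.
have n0 : (0 < n)%N by exact: leq_trans nN.
have n0R : 0 < n%:R :> R by rewrite ltr0n.
apply: (@le_trans _ _ ((n%:R^-1)%:E * lne K%:R%:E)%E).
  apply: lee_wpmul2l; first by rewrite lee_fin invr_ge0 ler0n.
  by apply: lne_mono; [exact: max_separated_ge0|exact: sepK].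
rewrite lne_EFin ?ltr0n // -EFinM lee_fin mulrC ler_pdivrMr // mulrC -ler_pdivrMr //.
apply: ltW; apply: lt_le_trans (truncnS_gt _) _.
by rewrite ler_nat.
Qed.

(* [horseshoe l] is coded by [l] in the full 2-shift embedded in the square of
   the tent map: [tent (tent (horseshoe (b :: l))) = horseshoe l]. *)
Fixpoint horseshoe (l : seq bool) : R :=
  if l is b :: l' then if b then 1 - horseshoe l' / 4 else horseshoe l' / 4 else 0.

Lemma horseshoe_itv l : 0 <= horseshoe l <= 1.
Proof. by elim: l => [|[] l IH] /=; lra. Qed.

(** [h / 4] and [1 - h / 4] are the outer inverse branches of the squared tent map. The images of
    the two branches of the tent map itself meet at 1/2, which gives no uniform gap; these lie in
    [[0, 1/4]] and [[3/4, 1]]. *)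
Lemma tent2_horseshoe b l : tent (tent (horseshoe (b :: l))) = horseshoe l.
Proof.
have /andP[h0 h1] := horseshoe_itv l; rewrite /tent /=; set h := horseshoe l in h0 h1 *.
case: b; first (case: (leP (1 - h / 4)) => [|_]; first lra).
- by case: (leP (2 - _)) => ?; lra.
- case: (leP (h / 4)) => [_|]; last lra.
  by case: (leP (2 * _)) => ?; lra.
Qed.

Lemma iter_tent_horseshoe j l : iter j.*2 (@tent_map R) (point (horseshoe l)) =
  point (horseshoe (drop j l)).
Proof.
elim: j l => [|j IH] l; first by rewrite drop0.
rewrite doubleS !iterSr; case: l => [|b l] /=.
  have -> : tent_map (point (0 : R)) = point 0.
    by rewrite /tent_map mxE /tent; case: leP => h; congr point; lra.
  rewrite (_ : tent_map _ = point 0) ?(IH [::]) //.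
  by rewrite /tent_map mxE /tent; case: leP => h; congr point; lra.
rewrite (_ : tent_map (tent_map _) = point (horseshoe l)) ?IH //.
by rewrite /tent_map !mxE tent2_horseshoe.
Qed.

Lemma horseshoe_separated m (l l' : m.-tuple bool) n : (m.*2 <= n)%N ->
  l != l' ->
  2^-1 <= rho_n (S := tent_system R) n (point (horseshoe l)) (point (horseshoe l')).
Proof.
move=> mn ll'; have [j [jm jl]] : exists j, (j < m)%N /\ nth false l j != nth false l' j.
  apply: contrapT => no; move/eqP: ll'; apply; apply: val_inj.
  apply: (@eq_from_nth _ false); rewrite ?size_tuple // => j jm.
  by apply/eqP/negPn/negP => jl; apply: no; exists j.
have j2n : (j.*2 < n)%N by lia.
apply: le_trans (le_bigmax _ _ (Ordinal j2n)).
rewrite rho_interval /= !iter_tent_horseshoe !mxE.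
have dropE (t : m.-tuple bool) : drop j t = nth false t j :: drop j.+1 t.
  by rewrite (drop_nth false) ?size_tuple.
rewrite !dropE /=.
have := horseshoe_itv (drop j.+1 l); have := horseshoe_itv (drop j.+1 l').
move: jl; case: (nth _ l j); case: (nth _ l' j) => // _ h h';
  rewrite ler_normr; apply/orP; lra.
Qed.

Lemma entropy_tent_gt0 : (0 < entropy (tent_system R))%E.
Proof.
rewrite entropyE.
have ln2 : 0 < ln (2 : R) by rewrite ln_gt0 // ltr1n.
apply: (@lt_le_trans _ _ (ln 2 / 4)%:E); first by rewrite lte_fin divr_gt0.
apply: (@le_trans _ _ (growth (tent_system R) 2^-1)); last first.
  by apply: ereal_sup_ubound; exists 2^-1 => //=; rewrite invr_gt0.
apply: (@limn_esup_ge _ _ 2) => n n2.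
have n0R : 0 < n%:R :> R by rewrite ltr0n; lia.
(* Each symbol costs two iterations, so all 2^m words are separated by time n; m >= n / 4 for n >= 2
   gives the rate ln 2 / 4. *)
pose m := n./2; have mn : (m.*2 <= n)%N by rewrite /m; lia.
apply: (@le_trans _ _ ((n%:R^-1)%:E * lne ((2 ^ m)%:R)%:E)%E).
  rewrite lne_EFin; last by rewrite ltr0n expn_gt0.
  rewrite -EFinM lee_fin natrX lnXn // -[ln 2 *+ m]mulr_natr [leRHS]mulrC ler_pdivlMr // -mulrA.
  rewrite ler_pM2l // ler_pdivrMl // -natrM ler_nat /m; lia.
apply: lee_wpmul2l; first by rewrite lee_fin invr_ge0 ler0n.
apply: lne_mono; first by rewrite lee_fin ler0n.
pose f (l : m.-tuple bool) : 'rV[R]_1 := point (horseshoe l).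
have sep l l' : l != l' -> 2^-1 <= rho_n (S := tent_system R) n (f l) (f l').
  exact: horseshoe_separated.
have f_inj : injective f.
  move=> l l' fl; apply/eqP/negPn/negP => /sep; rewrite fl => /le_trans => /(_ 0).
  have -> : rho_n (S := tent_system R) n (f l') (f l') <= 0; last by move=> /(_ isT); lra.
  by apply: bigmax_le => // i _; rewrite rho_interval subrr normr0.
apply: ereal_sup_ubound; exists [fset f l | l in {: m.-tuple bool}]%fset.
  split=> [x /= /imfsetP[l _ ->]|x y /imfsetP[l _ ->] /imfsetP[l' _ ->] ll'].
    by rewrite /unit_interval /= mxE horseshoe_itv.
  by apply: sep; apply: contra_notN ll' => /eqP->.
by rewrite card_imfset //= -cardE card_tuple card_bool.
Qed.

End TentEntropy.

(** * Continuity, compactness and connectedness *)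

Section Topological.
Variable R : realType.
Local Open Scope classical_set_scope.
Local Open Scope ring_scope.

Lemma topological_interval T (selfT : self_map (X := interval_space R) T) MT
    (MTP : map_discretization (X := interval_space R) T (@odd_dyadics R) MT) :
  continuous_map (X := interval_space R) T -> topological (interval_system selfT MTP).
Proof.
by split=> //; split; [exact: compact_unit_interval|exact: connected_unit_interval].
Qed.

Lemma tent_lipschitz (a b : R) : `|tent a - tent b| <= 2 * `|a - b|.
Proof.
rewrite /tent; have := ler_norm (a - b); have := ler_norm (b - a); rewrite distrC.
by case: (leP a 2^-1) => ?; case: (leP b 2^-1) => ?; rewrite ler_norml; lra.
Qed.

Lemma tent_topological : topological (tent_system R).
Proof.
apply: topological_interval => x e _ e0; exists (e / 2); first by rewrite divr_gt0.
move=> y _; rewrite !rho_interval !mxE => xy; apply: le_lt_trans (tent_lipschitz _ _) _.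
by rewrite mulrC -ltr_pdivlMr.
Qed.

Lemma id_topological : topological (id_system R).
Proof. by apply: topological_interval => x e _ e0; exists e. Qed.

End Topological.

Local Open Scope classical_set_scope.
Local Open Scope ring_scope.

Theorem proposition4p8 (R : realType)
    (entropy_invariant : forall S1 S2 : ed_system R,
      topological S1 -> topological S2 -> turing_equivalent S1 S2 ->
      ((0 < entropy S1)%E <-> (0 < entropy S2)%E)) :
  (exists (S : ed_system R) (D : telic_data S), hard D) /\
  class_P <> class_NP.
Proof.
have [S [D hD]] : exists (S : ed_system R) (D : telic_data S), hard D.
  apply: contrapT => no_hard.
  have all_easy (S : ed_system R) (D : telic_data S) : easy D.
    by apply: contrapT => hD; apply: no_hard; exists S, D.
  have [Dt Dt1] := interval_telic (@tent_self R) (@tent_map_discretization R).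
  have [Di Di1] := interval_telic (@id_self R) (@id_map_discretization R).
  have eqS : turing_equivalent (tent_system R) (id_system R).
    by split; [exact: easy_turing_le Di1|exact: easy_turing_le Dt1].
  have [/(_ (entropy_tent_gt0 R)) + _] :=
    entropy_invariant _ _ (@tent_topological R) (@id_topological R) eqS.
  by rewrite ltNge entropy_id_le0.
split; first by exists S, D.
by move=> PNP; apply: hD; rewrite /easy PNP; exact: telic_NP.
Qed.
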